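(* Let $\sigma>0$ be fixed. Let $(p_n)$ be a sequence of integers with $0\le p_n\le n$, $p_n\to\infty$ and $p_n=o(n)$ as $n\to\infty$, and let $\tau=\tau_n\in(0,1)$ with $\tau_n\to 0$. Suppose that, under $\mathbb{E}_{\theta_0}$, $Y\sim\mathcal{N}(\theta_0,\sigma^2 I_n)$. Then the horseshoe estimator $T_\tau$ satisfies, as $n\to\infty$, $$\sup_{\theta_0\in\ell_0[p_n]}\mathbb{E}_{\theta_0}\|T_\tau(Y)-\theta_0\|^2\lesssim p_n\log\frac1\tau+(n-p_n)\,\tau\sqrt{\log\frac1\tau}.$$
   Context: $\ell_0[p_n]:=\{\theta\in\mathbb{R}^n:\#\{1\le i\le n:\theta_i\ne 0\}\le p_n\}$; $\|\cdot\|$ is the Euclidean norm on $\mathbb{R}^n$. $A_n\lesssim B_n$ means there is a constant $c>0$ independent of $n$ with $A_n\le cB_n$ (for all sufficiently large $n$). Horseshoe prior with fixed parameter $\tau>0$: the pairs $(\lambda_i,\theta_i)$, $i=1,\dots,n$, are independent, $\lambda_i$ has the standard half-Cauchy distribution $C^+(0,1)$ on $(0,\infty)$, and $\theta_i\mid\lambda_i\sim\mathcal{N}(0,\sigma^2\tau^2\lambda_i^2)$. The posterior is the conditional law of $\theta=(\theta_1,\dots,\theta_n)$ given $Y=y$ when $Y\mid\theta\sim\mathcal{N}(\theta,\sigma^2I_n)$. The horseshoe estimator $T_\tau(y)=(T_\tau(y_1),\dots,T_\tau(y_n))$ is the posterior mean, $T_\tau(y_i)=\mathbb{E}[\theta_i\mid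 y_i,\tau]$ (the posterior factorizes over coordinates). *)

(* Defs.v *)
From HB Require Import structures.
From mathcomp Require Import all_boot all_order all_algebra.
From mathcomp Require Import all_classical all_reals all_analysis.
From mathcomp Require Import measurable_realfun giry.

Set Implicit Arguments.
Unset Strict Implicit.
Unset Printing Implicit Defensive.

Import Order.TTheory GRing.Theory Num.Def Num.Theory.
Import numFieldNormedType.Exports.

Local Open Scope classical_set_scope.
Local Open Scope ring_scope.

Section half_cauchy.
Context {R : realType}.
Local Notation mu := (@lebesgue_measure R).

(* The density of $C^+(0,1)$ with respect to Lebesgue measure. *)
Definition half_cauchy_pdf : R -> R :=
  (fun x => 2 / (pi * (1 + x ^+ 2))) \_ `]0, +oo[.

Lemma half_cauchy_pdf_ge0 x : 0 <= half_cauchy_pdf x.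
Proof.
apply: restrict_ge0 => {}x _.
by rewrite divr_ge0// mulr_ge0 ?pi_ge0// addr_ge0// sqr_ge0.
Qed.

Lemma measurable_half_cauchy_pdf : measurable_fun [set: R] half_cauchy_pdf.
Proof.
apply/measurable_restrict => //; apply: measurable_funTS.
apply: continuous_measurable_fun => x.
have -> : (fun x : R => 2 / (pi * (1 + x ^+ 2))) =
          (fun x => (2 / pi) * (oneDsqr x)^-1).
  by apply/funext => z; rewrite invfM mulrA.
apply: (@continuousM _ R^o (fun=> 2 / pi) (fun x => (oneDsqr x)^-1)).
  exact: cst_continuous.
exact: continuous_oneDsqrV.
Qed.

Lemma integral_half_cauchy_pdf :
  (\int[mu]_x (half_cauchy_pdf x)%:E = 1)%E.
Proof.
transitivity (\int[mu]_(x in `]0%R, +oo[) (2 / pi * (oneDsqr x)^-1)%:E)%E.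
  rewrite [RHS]integral_mkcond/=; apply: eq_integral => x _.
  rewrite /half_cauchy_pdf !patchE; case: ifPn => // _.
  by rewrite invfM mulrA.
under eq_integral do rewrite EFinM.
rewrite ge0_integralZl//=; last 2 first.
- apply: measurable_funTS; apply/measurable_EFinP.
  by apply: continuous_measurable_fun; exact: continuous_oneDsqrV.
- by rewrite lee_fin divr_ge0// pi_ge0.
have -> : (\int[mu]_(x in `]0%R, +oo[) (oneDsqr x)^-1%:E = (pi / 2)%:E)%E.
  rewrite -integral0y_oneDsqr; apply: integral_itv_obnd_cbnd.
  apply: measurable_funTS; apply/measurable_EFinP.
  by apply: continuous_measurable_fun; exact: continuous_oneDsqrV.
rewrite -EFinM; congr EFin.
by rewrite mulrC mulrA divfK ?divff// gt_eqF// pi_gt0.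
Qed.

Definition half_cauchy : set (measurableTypeR R) -> \bar R :=
  fun A => (\int[mu]_(x in A) (half_cauchy_pdf x)%:E)%E.

Let half_cauchy0 : half_cauchy set0 = 0%E.
Proof. by rewrite /half_cauchy integral_set0. Qed.

Let half_cauchy_ge0 A : (0 <= half_cauchy A)%E.
Proof.
by apply: integral_ge0 => x _; rewrite lee_fin half_cauchy_pdf_ge0.
Qed.

Let half_cauchy_sigma_additive : semi_sigma_additive half_cauchy.
Proof.
move=> /= F mF tF mUF; rewrite /half_cauchy; apply: cvg_toP.
  apply: ereal_nondecreasing_is_cvgn => m n mn.
  apply: lee_sum_nneg_natr => // k _ _; apply: integral_ge0 => /= x Fkx.
  by rewrite lee_fin half_cauchy_pdf_ge0.
rewrite ge0_integral_bigcup//=.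
- apply/measurable_funTS/measurableT_comp => //.
  exact: measurable_half_cauchy_pdf.
- by move=> x _; rewrite lee_fin half_cauchy_pdf_ge0.
Qed.

HB.instance Definition _ := isMeasure.Build _ _ _ half_cauchy
  half_cauchy0 half_cauchy_ge0 half_cauchy_sigma_additive.

Let half_cauchy_setT : half_cauchy [set: _] = 1%E.
Proof. exact: integral_half_cauchy_pdf. Qed.

HB.instance Definition _ :=
  Measure_isProbability.Build _ _ _ half_cauchy half_cauchy_setT.

End half_cauchy.

Section horseshoe.
Context {R : realType}.
Local Notation mu := (@lebesgue_measure R).
Local Notation mR := (measurableTypeR R).

Lemma measurable_normal_pdf_scale (a : R) :
  measurable_fun [set: mR * mR]
    (fun z : mR * mR => normal_pdf 0 (a * z.1) z.2 : R).
Proof.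
have m1 : measurable_fun [set: mR * mR] (fun z : mR * mR => a * z.1 : R).
  by apply: measurable_funM => //; exact: measurable_fst.
have m2 : measurable_fun [set: mR * mR] (fun z : mR * mR => z.2 : R).
  exact: measurable_snd.
have mpow (f : mR * mR -> R) (p : R) : measurable_fun [set: mR * mR] f ->
    measurable_fun [set: mR * mR] (fun z => f z `^ p).
  by move=> mf; apply: (measurableT_comp (measurable_powR p)).
have m3 : measurable_fun [set: mR * mR] (fun z : mR * mR => (a * z.1) ^+ 2 : R).
  exact: measurable_funX.
rewrite /normal_pdf; apply: measurable_fun_ifT.
- exact: measurable_fun_eqr.
- by apply: (measurableT_comp _ m2) => //; exact: measurable_indic.
- apply: measurable_funM.
  + rewrite (_ : (fun _ => _) =
        fun z : mR * mR => (((a * z.1) ^+ 2 * (pi *+ 2)) `^ 2^-1) `^ (-1)).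
      by do 2 apply: (mpow); exact: measurable_funM.
    apply/funext => z; rewrite powR_inv1 ?powR_ge0// powR12_sqrt; last first.
      by rewrite mulr_ge0 ?sqr_ge0// mulrn_wge0// pi_ge0.
    by rewrite /normal_peak -[in LHS]mulrnAr.
  + apply: measurableT_comp => //=; apply: measurable_funM.
      apply: measurableT_comp => //=; apply: measurable_funX.
      by apply: measurable_funB.
    rewrite (_ : (fun _ => _) =
        fun z : mR * mR => ((a * z.1) ^+ 2 * 2) `^ (-1)).
      by apply: mpow; exact: measurable_funM.
    apply/funext => z; rewrite powR_inv1; first by rewrite mulr_natr.
    by rewrite mulr_ge0 ?sqr_ge0.
Qed.

(* The second parameter of normal_prob is the standard deviation. When it is
   zero, normal_prob is by convention a uniform distribution, but for nonzero
   sigma and tau this happens only at lambda = 0, a half_cauchy-null set. *)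
Definition normal_scale (sigma tau : R) (lambda : mR) : giry mR R :=
  normal_prob 0 (sigma * tau * lambda).

Lemma measurable_normal_scale sigma tau :
  measurable_fun [set: mR] (normal_scale sigma tau).
Proof.
apply: measurable_giry_codensity => // B mB.
rewrite /normal_scale/= /normal_prob.
under eq_fun do rewrite integral_mkcond.
pose f (z : mR * mR) :=
  ((normal_pdf 0 (sigma * tau * z.1) z.2 * \1_B z.2)%:E)%E.
apply: (eq_measurable_fun (fubini_F mu f)).
  move=> l _; apply: eq_integral => x _.
  by rewrite /f /= patchE indicE; case: ifPn => xB; rewrite ?mulr1 ?mulr0.
apply: measurable_fun_fubini_tonelli_F.
  apply/measurable_EFinP; apply: measurable_funM.
    exact: measurable_normal_pdf_scale.
  apply: (measurableT_comp _ measurable_snd) => //; exact: measurable_indic.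
by move=> z; rewrite lee_fin mulr_ge0// normal_pdf_ge0.
Qed.

(* The marginal law of theta_i when lambda_i is half-Cauchy and theta_i given
   lambda_i is centred normal with standard deviation sigma tau lambda_i. *)
Definition horseshoe_prior (sigma tau : R) : giry mR R :=
  giry_bind (half_cauchy : giry mR R) (measurable_normal_scale sigma tau).

Lemma horseshoe_prior_setT sigma tau : horseshoe_prior sigma tau setT = 1%E.
Proof.
transitivity (giry_int (horseshoe_prior sigma tau) (cst 1%E)).
  by rewrite /giry_int integral_cst// mul1e.
rewrite giry_int_bind// /giry_int.
transitivity (\int[half_cauchy]_(_ in [set: mR]) (1 : \bar R))%E.
  apply: eq_integral => x _; rewrite integral_cst// mul1e.
  exact: (@probability_setT _ _ _ (normal_prob 0 (sigma * tau * x))).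
rewrite integral_cst// mul1e; exact: (@probability_setT _ _ _ half_cauchy).
Qed.

Lemma measurable_normal_likelihood (sigma y : R) :
  measurable_fun [set: mR] (fun theta : mR => (normal_pdf theta sigma y)%:E).
Proof.
apply/measurable_EFinP; rewrite /normal_pdf.
apply: measurable_fun_ifT => //.
apply: measurable_funM => //; apply: measurableT_comp => //=.
apply: measurable_funM => //; apply: measurableT_comp => //=.
by apply: measurable_funX; apply: measurable_funB.
Qed.

Section posterior.
Variables (sigma tau y : R).

(* The numerator of Bayes' formula for theta_i given Y_i = y; its total mass is
   the marginal density of Y_i at y. *)
Definition horseshoe_weight (A : set mR) : \bar R :=
  (\int[horseshoe_prior sigma tau]_(theta in A)
     (normal_pdf theta sigma y)%:E)%E.

Let horseshoe_weight0 : horseshoe_weight set0 = 0%E.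
Proof. by rewrite /horseshoe_weight integral_set0. Qed.

Let horseshoe_weight_ge0 A : (0 <= horseshoe_weight A)%E.
Proof. by apply: integral_ge0 => x _; rewrite lee_fin normal_pdf_ge0. Qed.

Let horseshoe_weight_sigma_additive : semi_sigma_additive horseshoe_weight.
Proof.
move=> /= F mF tF mUF; rewrite /horseshoe_weight; apply: cvg_toP.
  apply: ereal_nondecreasing_is_cvgn => m n mn.
  apply: lee_sum_nneg_natr => // k _ _; apply: integral_ge0 => /= x Fkx.
  by rewrite lee_fin normal_pdf_ge0.
rewrite ge0_integral_bigcup//=.
- by apply: measurable_funTS; exact: measurable_normal_likelihood.
- by move=> x _; rewrite lee_fin normal_pdf_ge0.
Qed.

HB.instance Definition _ := isMeasure.Build _ _ _ horseshoe_weight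
  horseshoe_weight0 horseshoe_weight_ge0 horseshoe_weight_sigma_additive.

Lemma horseshoe_weight_fin : sigma != 0 ->
  (0 < horseshoe_weight [set: mR] < +oo)%E.
Proof.
move=> s0; apply/andP; split.
  rewrite lt0e horseshoe_weight_ge0 andbT; apply/negP => /eqP w0.
  have /ae_eq_integral_abs : (\int[horseshoe_prior sigma tau]_(x in [set: mR])
      `|(normal_pdf x sigma y)%:E| = 0)%E.
    rewrite -w0; apply: eq_integral => x _.
    by rewrite gee0_abs// lee_fin normal_pdf_ge0.
  move=> /(_ measurableT (measurable_normal_likelihood sigma y)).
  move=> [N [mN N0]] /(_ _)/= sub.
  have : (1 <= 0 :> \bar R)%E.
    rewrite -(horseshoe_prior_setT sigma tau) -[leRHS]N0.
    apply: le_measure; rewrite ?inE// => x _; apply: sub => /(_ I).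
    move=> [] /eqP; apply/negP; rewrite gt_eqF// normal_pdfE// mulr_gt0//.
      exact: normal_peak_gt0.
    exact: expR_gt0.
  by rewrite leNgt lte01.
apply: (@le_lt_trans _ _ (\int[horseshoe_prior sigma tau]_(_ in [set: mR])
    (normal_peak sigma)%:E)%E); last first.
  by rewrite integral_cst// [X in (_ * X)%E](horseshoe_prior_setT sigma tau)
    mule1 ltry.
apply: ge0_le_integral => //.
- by move=> x _; rewrite lee_fin normal_pdf_ge0.
- exact: measurable_normal_likelihood.
- by move=> x _; rewrite lee_fin normal_pdf_ub.
Qed.

(* By horseshoe_weight_fin, the default measure passed to mnormalize (used when
   the mass to be normalised is 0 or infinite) is irrelevant if sigma != 0. *)
Definition horseshoe_posterior : probability mR R :=
  mnormalize horseshoe_weight (\d_(0 : mR)).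

Definition horseshoe_mean : R := fine 'E_horseshoe_posterior[idfun].

End posterior.

End horseshoe.

Section normal_vector.
Context {R : realType}.
Local Notation mR := (measurableTypeR R).

Definition tuple_cons n (z : mR * n.-tuple mR) : n.+1.-tuple mR :=
  [tuple of z.1 :: z.2].

Lemma measurable_tuple_cons n :
  measurable_fun [set: mR * n.-tuple mR] (@tuple_cons n).
Proof. by apply: measurable_cons. Qed.

HB.instance Definition _ n := @isMeasurableFun.Build _ _ _ _ (@tuple_cons n)
  (@measurable_tuple_cons n).

(* The law $\mathcal{N}(\theta, \sigma^2 I_n)$ on $\mathbb{R}^n$, built as the
   n-fold product of the laws $\mathcal{N}(\theta_i, \sigma^2)$; it is
   characterised by normal_vectorE. *)
Fixpoint normal_vector (sigma : R) n :
    n.-tuple mR -> probability (n.-tuple mR) R :=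
  match n with
  | 0 => fun=> \d_([tuple] : 0.-tuple mR)
  | n'.+1 => fun theta =>
      distribution (normal_prob (thead theta) sigma \x
                    normal_vector sigma [tuple of behead theta])%E
                   (@tuple_cons n')
  end.

Lemma normal_vectorE sigma n (theta : n.-tuple mR) (A : 'I_n -> set mR) :
  (forall i, measurable (A i)) ->
  normal_vector sigma theta [set y | forall i, A i (tnth y i)] =
  (\prod_(i < n) normal_prob (tnth theta i) sigma (A i))%E.
Proof.
elim: n theta A => [|n IH] theta A mA.
  rewrite big_ord0 /= /dirac indicE mem_set//.
  by case.
rewrite big_ord_recl /= /distribution /pushforward.
rewrite [X in (_ \x _)%E X](_ : _ = A ord0 `*`
    [set y | forall i, A (lift ord0 i) (tnth y i)]); last first.
  apply/seteqP; split => [[x y] /= H|[x y] /= [Ax Ay] i].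
    split; first by have := H ord0; rewrite /tuple_cons/= tnth0.
    by move=> i; have := H (lift ord0 i); rewrite /tuple_cons/= tnthS.
  by case: (unliftP ord0 i) => [j ->|->]; rewrite /tuple_cons/= ?tnth0 ?tnthS.
rewrite product_measure1E//; last first.
  rewrite (_ : [set y | _] = \bigcap_(i in [set: 'I_n])
      ((fun y : n.-tuple mR => tnth y i) @^-1` A (lift ord0 i))); last first.
    by apply/seteqP; split => y /= H i; [move=> _; exact: H|exact: H].
  apply: fin_bigcap_measurable => // i _.
  by rewrite -[X in measurable X]setTI; exact: measurable_tnth.
congr (_ * _)%E.
rewrite [LHS](IH [tuple of behead theta] (fun i => A (lift ord0 i)))//.
by apply: eq_bigr => i _; rewrite [in RHS](tuple_eta theta) tnthS.
Qed.

End normal_vector.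

Section risk.
Context {R : realType}.
Local Notation mR := (measurableTypeR R).

Definition horseshoe_estimator (sigma tau : R) n (y : n.-tuple mR) :
    n.-tuple mR :=
  [tuple horseshoe_mean sigma tau (tnth y i) | i < n].

Definition euclidean_norm n (x : 'I_n -> R) : R :=
  Num.sqrt (\sum_(i < n) x i ^+ 2).

End risk.

(* $\ell_0[p]$ in $\mathbb{R}^n$ *)
Definition nearly_black (R : realType) n (p : nat) :
    set (n.-tuple (measurableTypeR R)) :=
  [set theta | (#|[pred i | (tnth theta i : R) != 0%R]| <= p)%N].
Arguments nearly_black R n p : clear implicits.

(* Main.v *)
From HB Require Import structures.
Require Import Defs.
From mathcomp Require Import all_boot all_order all_algebra.
From mathcomp Require Import all_classical all_reals all_analysis.
From mathcomp Require Import measurable_realfun giry ring lra.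

(** Both the prior and the likelihood factorize, so the risk is the sum of the
    risks in the single coordinates ([horseshoe_riskE]), and everything is
    about the one-dimensional posterior mean T(y).

    Given lambda, everything is Gaussian: the posterior mean is (1 - s) y with
    s = 1 / (1 + tau^2 lambda^2), and the posterior density of lambda is
    proportional to sqrt s * exp (- x s), where x = y^2 / (2 sigma^2), times the
    half-Cauchy density. Hence T(y) = y (1 - S / Q), where Q is the half-Cauchy
    integral of sqrt s * exp (- x s) and S is that of s times this function
    ([horseshoe_meanE]).

    Put L = ln (1 / tau). Two pointwise estimates of T are enough.

    - For a nonzero mean, T stays close to the observation: |y - T(y)| is at
      most a constant times sqrt L, uniformly in y
      ([sqr_sub_horseshoe_mean_le]). If |y| is of order sqrt L at most, this
      holds because |y - T(y)| <= |y|. Otherwise S is split at a level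
      s0 = (3 ln z + L) / z^2 with z = sqrt x: scales with s <= s0 contribute
      at most s0 Q to S, the others at most exp (- x s0), and Q is at least of
      order tau / x because of the scales lambda between z / tau and 2 z / tau. So
      the risk in such a coordinate is at most a constant times L
      ([coordinate_risk_le]).

    - For a zero mean, T shrinks: Q - S <= tau and Q >= exp (- x) / (2 pi), so
      |T(y)| <= 2 pi tau exp x |y| ([sqr_horseshoe_mean_le_expR]). This is used
      for |y| <= zeta = sigma sqrt (2 L), where exp x <= 1 / tau; there the
      integral of T^2 against the Gaussian density is at most of order
      tau^2 zeta exp (zeta^2 / (2 sigma^2)) = tau zeta. Beyond zeta the bound
      |T(y)| <= |y| is used, and the Gaussian tail of y^2 is of order tau zeta
      as well. So the risk is at most a constant times tau sqrt L
      ([coordinate_risk0_le]).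

    Summing over at most p_n coordinates of the first kind and the remaining
    ones of the second kind gives the theorem; the zero coordinates in excess
    of n - p_n are absorbed in p_n L since tau sqrt L <= L as soon as
    L >= 1. *)

Set Implicit Arguments.
Unset Strict Implicit.
Unset Printing Implicit Defensive.

Import Order.TTheory GRing.Theory Num.Def Num.Theory.
Import numFieldNormedType.Exports.

Local Open Scope classical_set_scope.
Local Open Scope ring_scope.

Lemma eq_leW d (T : porderType d) (x y : T) : x = y -> (x <= y)%O.
Proof. by move->. Qed.

(** * Integration against densities, mixtures and product laws *)

Section density.
Local Open Scope ereal_scope.
Context d (T : measurableType d) (R : realType).
Variables (nu mu : {measure set T -> \bar R}) (g : T -> R).
Hypotheses (mg : measurable_fun [set: T] g) (g0 : forall x, (0 <= g x)%R).
Hypothesis nuE : forall A, measurable A -> nu A = \int[mu]_(x in A) (g x)%:E.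

Import HBNNSimple.

Let mgE : measurable_fun [set: T] (EFin \o g).
Proof. exact/measurable_EFinP. Qed.

(** By definition for indicators, hence for simple functions, and then by
    monotone convergence. *)
Lemma ge0_integral_density (f : T -> \bar R) :
  (forall x, 0 <= f x) -> measurable_fun [set: T] f ->
  \int[nu]_x f x = \int[mu]_x (f x * (g x)%:E).
Proof.
move=> f0 mf; pose h := nnsfun_approx measurableT mf.
have hcvg x : EFin \o h ^~ x @ \oo --> f x by exact: cvg_nnsfun_approx.
have -> : \int[nu]_x f x = limn (fun n => \int[nu]_x (h n x)%:E).
  rewrite -monotone_convergence//.
  - by apply: eq_integral => x _; apply/esym/cvg_lim => //; exact: hcvg.
  - by move=> n; exact/measurable_EFinP.
  - by move=> n x _; rewrite lee_fin.
  - by move=> x _ a b ab; rewrite lee_fin; exact/lefP/nd_nnsfun_approx.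
have -> : \int[mu]_x (f x * (g x)%:E) =
    limn (fun n => \int[mu]_x ((h n x)%:E * (g x)%:E)).
  rewrite -monotone_convergence//.
  - apply: eq_integral => x _; apply/esym/cvg_lim => //.
    by apply: cvgeZr => //; exact: hcvg.
  - by move=> n; apply: emeasurable_funM => //; exact/measurable_EFinP.
  - by move=> n x _; rewrite mule_ge0 ?lee_fin.
  - move=> x _ a b ab; rewrite lee_wpmul2r ?lee_fin//.
    exact/lefP/nd_nnsfun_approx.
congr (limn _); apply/funext => n.
transitivity (\sum_(y \in range (h n)) y%:E * nu (h n @^-1` [set y])).
  by rewrite integralT_nnsfun sintegralE.
transitivity (\int[mu]_x (\sum_(y \in range (h n))
    (y * \1_(h n @^-1` [set y]) x)%:E * (g x)%:E)); last first.
  apply: eq_integral => x _; rewrite -ge0_mule_fsuml => [|y].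
    by rewrite fsumEFin// -(fimfunE _ x).
  exact: nnfun_muleindic_ge0.
rewrite ge0_integral_fsum//; last 2 first.
- by move=> y; apply: emeasurable_funM => //; apply/measurable_EFinP;
    exact: measurable_funM.
- move=> m y _; apply: mule_ge0; last by rewrite lee_fin.
  by rewrite EFinM; exact: nnfun_muleindic_ge0.
apply: eq_fsbigr => r rhn.
have r0 : (0 <= r)%R by move: rhn; rewrite inE => -[t _ <-].
rewrite nuE//; under [RHS]eq_integral do rewrite EFinM -muleA.
rewrite ge0_integralZl//; last 2 first.
- by apply: emeasurable_funM => //; exact/measurable_EFinP.
- by move=> t _; rewrite mule_ge0 ?lee_fin.
congr (_ * _); rewrite integral_mkcond; apply: eq_integral => x _.
by rewrite epatch_indic/= muleC.
Qed.

(** Integrability of [f] is not an issue: the density is nonnegative, so that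
    multiplying by it commutes with taking positive and negative parts. *)
Lemma integral_density (f : T -> \bar R) : measurable_fun [set: T] f ->
  \int[nu]_x f x = \int[mu]_x (f x * (g x)%:E).
Proof.
move=> mf; rewrite integralE [RHS]integralE; congr (_ - _).
- rewrite ge0_integral_density//; last exact: measurable_funepos.
  apply: eq_integral => x _; rewrite !funeposE.
  have [f0|f0] := leP 0 (f x); first by rewrite max_l ?mule_ge0 ?lee_fin.
  by rewrite max_r ?mul0e// mule_le0_ge0 ?lee_fin// ltW.
- rewrite ge0_integral_density//; last exact: measurable_funeneg.
  apply: eq_integral => x _; rewrite !funenegE -mulNe.
  have [f0|f0] := leP 0 (- f x); first by rewrite max_l ?mule_ge0 ?lee_fin.
  by rewrite max_r ?mul0e// mule_le0_ge0 ?lee_fin// ltW.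
Qed.

End density.

Section giry_bind_bounded.
Local Open Scope ereal_scope.
Context d1 d2 (T1 : measurableType d1) (T2 : measurableType d2) (R : realType).
Variables (mu : probability T1 R) (k : T1 -> giry T2 R).
Hypothesis mk : measurable_fun [set: T1] k.

Lemma measurable_integral_giry (f : T2 -> \bar R) :
  measurable_fun [set: T2] f ->
  measurable_fun [set: T1] (fun x => \int[k x]_t f t).
Proof.
move=> mf; have mfp := measurable_funepos mf; have mfn := measurable_funeneg mf.
rewrite (_ : (fun x => _) = (fun x => \int[k x]_t f^\+ t) \-
    (fun x => \int[k x]_t f^\- t)); last first.
  by apply/funext => x; rewrite integralE.
apply: emeasurable_funB.
- by apply: (measurableT_comp (measurable_giry_int mfp _) mk).
- by apply: (measurableT_comp (measurable_giry_int mfn _) mk).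
Qed.

Lemma integrable_giry_int (h : T2 -> \bar R) (M : R) :
    measurable_fun [set: T2] h -> (forall x, 0 <= h x <= M%:E) ->
  mu.-integrable [set: T1] (fun x => \int[k x]_t h t).
Proof.
move=> mh h0M.
have h0 x : 0 <= h x by case/andP: (h0M x).
have mgh := measurable_integral_giry mh.
have M0 (t : T2) : (0 <= M)%R.
  by case/andP: (h0M t) => h0t hM; rewrite -lee_fin (le_trans h0t).
apply: (le_integrable measurableT mgh _
  (finite_measure_integrable_cst mu `|M| measurableT)) => x _.
rewrite gee0_abs ?integral_ge0//= normr_id.
apply: (@le_trans _ _ (\int[k x]_t `|M|%:E)).
  apply: ge0_le_integral => // t _; have /andP[_ /le_trans] := h0M t; apply.
  by rewrite lee_fin ler_norm.
rewrite integral_cst// -[leRHS]mule1 lee_wpmul2l ?lee_fin//.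
exact: sprobability_setT.
Qed.

(** The law of iterated expectations is applied to the positive and negative
    parts; boundedness makes both inner integrals integrable, so that their
    difference can be recombined. *)
Lemma integral_giry_bind_bounded (f : T2 -> \bar R) (M : R) :
    measurable_fun [set: T2] f -> (forall x, `|f x| <= M%:E) ->
  \int[giry_bind (mu : giry T1 R) mk]_x f x = \int[mu]_x \int[k x]_t f t.
Proof.
move=> mf fM.
have mfp : measurable_fun [set: T2] f^\+ by exact: measurable_funepos.
have mfn : measurable_fun [set: T2] f^\- by exact: measurable_funeneg.
have fpM x : 0 <= f^\+ x <= M%:E.
  rewrite funepos_ge0 (le_trans _ (fM x))// -[leRHS]/((abse \o f) x).
  by rewrite fune_abse leeDl// funeneg_ge0.
have fnM x : 0 <= f^\- x <= M%:E.
  rewrite funeneg_ge0 (le_trans _ (fM x))// -[leRHS]/((abse \o f) x).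
  by rewrite fune_abse leeDr// funepos_ge0.
rewrite integralE.
have -> : \int[giry_bind (mu : giry T1 R) mk]_x f^\+ x =
    \int[mu]_x \int[k x]_t f^\+ t by exact: giry_int_bind.
have -> : \int[giry_bind (mu : giry T1 R) mk]_x f^\- x =
    \int[mu]_x \int[k x]_t f^\- t by exact: giry_int_bind.
rewrite -integralB//; first last.
- exact: integrable_giry_int fnM.
- exact: integrable_giry_int fpM.
by apply: eq_integral => x _ /=; rewrite [RHS]integralE.
Qed.

End giry_bind_bounded.

Section coordinates.
Local Open Scope ereal_scope.
Context (R : realType).
Local Notation mR := (measurableTypeR R).

(** The coordinate projection pushes the product law forward to its marginal,
    which [normal_vectorE] identifies on boxes with a single constrained
    side. *)
Lemma ge0_integral_normal_vector_tnth (sigma : R) n (theta : n.-tuple mR) i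
    (g : mR -> \bar R) :
  (forall x, 0 <= g x) -> measurable_fun [set: mR] g ->
  \int[normal_vector sigma theta]_y g (tnth y i) =
  \int[normal_prob (tnth theta i) sigma]_x g x.
Proof.
move=> g0 mg.
have mi : measurable_fun [set: n.-tuple mR] (fun y => tnth y i : mR).
  exact: measurable_tnth.
pose phi : {mfun n.-tuple mR >-> mR} :=
  HB.pack (fun y : n.-tuple mR => tnth y i : mR)
          (isMeasurableFun.Build _ _ _ _ _ mi).
have <- : \int[pushforward (normal_vector sigma theta) phi]_x g x =
    \int[normal_vector sigma theta]_y g (tnth y i).
  exact: (ge0_integral_pushforward mi).
apply: eq_measure_integral => A mA _.
rewrite -[LHS]/(normal_vector sigma theta [set y | A (tnth y i)]).
pose B j := if j == i then A else [set: mR].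
rewrite [X in normal_vector _ _ X](_ : _ = [set y | forall j, B j (tnth y j)]).
  rewrite normal_vectorE => [|j]; last by rewrite /B; case: ifP.
  rewrite (bigD1 i)//= /B eqxx big1 ?mule1// => j /negPf ->.
  exact: probability_setT.
apply/seteqP; split => y /=; last by move=> /(_ i); rewrite /B eqxx.
by move=> Ay j; rewrite /B; case: eqVneq => [->|].
Qed.

End coordinates.

(** * Gaussian integrals *)

Section ftc_is_derive.
Context (R : realType).
Local Notation mu := (@lebesgue_measure R).
Variables (F f : R -> R).
Hypotheses (dF : forall x : R, is_derive x 1 F (f x)) (cf : continuous f).

Let F'E x : (F^`()%classic) x = f x.
Proof. by rewrite derive1E; exact: derive_val. Qed.

Let derF (x : R) : derivable F x 1. Proof. exact: ex_derive. Qed.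

Let cF : continuous F.
Proof. by move=> x; apply/differentiable_continuous/derivable1_diffP. Qed.

Lemma integral_itv_is_derive a b : a <= b ->
  (\int[mu]_(x in `[a, b]) (f x)%:E = (F b - F a)%:E)%E.
Proof.
rewrite le_eqVlt => /predU1P[<-|ab].
  by rewrite set_itv1 integral_set1 subrr.
rewrite EFinB; apply: continuous_FTC2 => //.
- exact: continuous_subspaceT.
- split => //.
  + by apply: cvg_at_right_filter; exact: cF.
  + by apply: cvg_at_left_filter; exact: cF.
Qed.

Lemma ge0_integral_itvy_is_derive a l : (forall x, a <= x -> 0 <= f x) ->
  F x @[x --> +oo] --> l ->
  (\int[mu]_(x in `[a, +oo[) (f x)%:E = (l - F a)%:E)%E.
Proof.
move=> f0 Fl; rewrite EFinB; apply: ge0_continuous_FTC2y => //.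
- exact: continuous_subspaceT.
- by apply: cvg_at_right_filter; exact: cF.
Qed.

End ftc_is_derive.

Section gaussian.
Context (R : realType).
Local Notation mu := (@lebesgue_measure R).
Implicit Types (m s x y : R).

Lemma is_derive_normal_fun m s (x : R) :
  is_derive x 1 (normal_fun m s) (- (x - m) / s ^+ 2 * normal_fun m s x).
Proof.
pose h (z : R) : R := - (z - m) ^+ 2 / (s ^+ 2 *+ 2).
have dh : is_derive x 1 h (- (x - m) / s ^+ 2).
  rewrite /h; apply: is_derive_eq.
  rewrite /GRing.scale/= -mulr_natr invfM.
  by set A := (s ^+ 2)^-1; field.
rewrite (_ : normal_fun m s = expR \o h)// mulrC.
exact: is_derive1_comp.
Qed.

(** This is t exp (- t) <= 1 at t = (x - m)^2 / (2 s^2). *)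
Lemma sqr_normal_fun_le m s x : s != 0 ->
  (x - m) ^+ 2 * normal_fun m s x <= s ^+ 2 *+ 2.
Proof.
move=> s0; have s2 : 0 < s ^+ 2 *+ 2 by rewrite pmulrn_lgt0// exprn_even_gt0.
rewrite /normal_fun mulNr expRN ler_pdivrMr ?expR_gt0//.
rewrite mulrC -ler_pdivrMr//.
by apply: le_trans (expR_ge1Dx _); rewrite lerDr.
Qed.

Lemma normal_fun_cvgy m s : s != 0 -> normal_fun m s x @[x --> +oo] --> 0.
Proof.
move=> s0; apply/cvgrPdist_le => /= e e0; near=> x.
rewrite sub0r normrN ger0_norm ?normal_fun_ge0//.
have x1 : m + 1 <= x.
  by near: x; apply: nbhs_pinfty_ge; exact: num_real.
have x2 : m + s ^+ 2 *+ 2 / e <= x.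
  by near: x; apply: nbhs_pinfty_ge; exact: num_real.
have u1 : 1 <= x - m by rewrite lerBrDl.
have u2 : s ^+ 2 *+ 2 <= e * (x - m) by rewrite -ler_pdivrMl// mulrC lerBrDl.
have u0 : 0 < (x - m) ^+ 2 by rewrite exprn_gt0// (lt_le_trans ltr01).
rewrite -(ler_pM2l u0) (le_trans (sqr_normal_fun_le m x s0))//.
rewrite (le_trans u2)// mulrC ler_pM2r// expr2 ler_peMr// ltW//.
by rewrite (lt_le_trans ltr01).
Unshelve. all: by end_near. Qed.

Lemma mul_normal_fun_cvgy s : s != 0 ->
  x * normal_fun 0 s x @[x --> +oo] --> 0.
Proof.
move=> s0; apply/cvgrPdist_le => /= e e0; near=> x.
have x0 : 0 < x by near: x; apply: nbhs_pinfty_gt; exact: num_real.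
have x2 : s ^+ 2 *+ 2 / e <= x.
  by near: x; apply: nbhs_pinfty_ge; exact: num_real.
rewrite sub0r normrN ger0_norm ?mulr_ge0 ?normal_fun_ge0 ?(ltW x0)//.
have := sqr_normal_fun_le 0 x s0; rewrite subr0 => h.
rewrite -(ler_pM2l x0) mulrA -expr2 (le_trans h)//.
by rewrite -ler_pdivrMr// mulrC.
Unshelve. all: by end_near. Qed.

Lemma continuous_normal_fun m s : continuous (normal_fun m s).
Proof.
move=> x; apply/differentiable_continuous/derivable1_diffP.
by apply: ex_derive; exact: is_derive_normal_fun.
Qed.

Lemma normal_prob_integral m s (f : R -> \bar R) :
  measurable_fun [set: R] f ->
  (\int[normal_prob m s]_x f x = \int[mu]_x (f x * (normal_pdf m s x)%:E))%E.
Proof.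
move=> mf; apply: integral_density => //.
- exact: measurable_normal_pdf.
- exact: normal_pdf_ge0.
Qed.

Lemma integral_normal_fun_ge m s : s != 0 ->
  (\int[mu]_(x in `[m, +oo[) ((x - m) * normal_fun m s x)%:E = (s ^+ 2)%:E)%E.
Proof.
move=> s0; pose F x := - (s ^+ 2) * normal_fun m s x.
have dF (x : R) : is_derive x 1 F ((x - m) * normal_fun m s x).
  have := is_derive_normal_fun m s x => dn.
  apply: is_derive_eq; rewrite /GRing.scale/=; field.
  by [].
rewrite (ge0_integral_itvy_is_derive dF _ _ (l := 0)).
- by rewrite /F /normal_fun subrr expr0n/= oppr0 mul0r expR0 mulr1 sub0r opprK.
- move=> x; apply: cvgM; last exact: continuous_normal_fun.
  by apply: cvgB; [exact: cvg_id|exact: cvg_cst].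
- by move=> x mx; rewrite mulr_ge0 ?subr_ge0 ?normal_fun_ge0.
- rewrite -(mulr0 (- s ^+ 2)); apply: cvgMr; exact: normal_fun_cvgy.
Qed.

Lemma integral_normal_fun_le m s : s != 0 ->
  (\int[mu]_(x in `]-oo, m]) ((m - x) * normal_fun m s x)%:E = (s ^+ 2)%:E)%E.
Proof.
move=> s0; rewrite -(integral_normal_fun_ge (- m) s0) -{1}(opprK m).
rewrite ge0_integration_by_substitutionNy.
- apply: eq_integral => x _ /=; rewrite /normal_fun !opprK (addrC m).
  by rewrite -(sqrrN (- x - m)) opprB opprK (addrC m).
- apply: continuous_subspaceT => x.
  apply: cvgM; last exact: continuous_normal_fun.
  by apply: cvgB; [exact: cvg_cst|exact: cvg_id].
- move=> x; rewrite in_itv/= opprK => xm.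
  by rewrite mulr_ge0 ?subr_ge0 ?normal_fun_ge0// ltW.
Qed.

Let center_pdf m s x := ((x - m) * normal_pdf m s x)%:E.

Let measurable_center_pdf m s : measurable_fun [set: R] (center_pdf m s).
Proof.
apply/measurable_EFinP/measurable_funM; last exact: measurable_normal_pdf.
exact: measurable_funB.
Qed.

Let center_pdf_pos m s : s != 0 ->
  (\int[mu]_x (center_pdf m s)^\+ x = (normal_peak s * s ^+ 2)%:E)%E.
Proof.
move=> s0; rewrite EFinM -(integral_normal_fun_ge m s0) -ge0_integralZl//=.
- rewrite [RHS]integral_mkcond; apply: eq_integral => x _.
  rewrite funeposE /center_pdf normal_pdfE// mulrCA patchE.
  case: ifPn => [|]; rewrite ?notin_setE ?inE/= in_itv/= andbT => mx.
    rewrite max_l// lee_fin.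
    by rewrite !mulr_ge0 ?normal_peak_ge0 ?normal_fun_ge0 ?subr_ge0.
  rewrite max_r// lee_fin mulr_ge0_le0 ?normal_peak_ge0//.
  rewrite mulr_le0_ge0 ?normal_fun_ge0//.
  by rewrite subr_le0 leNgt; apply/negP => /ltW.
- apply: measurable_funTS; apply/measurable_EFinP/measurable_funM.
    exact: measurable_funB.
  exact: measurable_normal_fun.
- move=> x; rewrite in_itv/= andbT => mx.
  by rewrite lee_fin mulr_ge0 ?normal_fun_ge0 ?subr_ge0.
- by rewrite lee_fin normal_peak_ge0.
Qed.

Let center_pdf_neg m s : s != 0 ->
  (\int[mu]_x (center_pdf m s)^\- x = (normal_peak s * s ^+ 2)%:E)%E.
Proof.
move=> s0; rewrite EFinM -(integral_normal_fun_le m s0) -ge0_integralZl//=.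
- rewrite [RHS]integral_mkcond; apply: eq_integral => x _.
  rewrite funenegE /center_pdf normal_pdfE// mulrCA patchE -EFinN.
  rewrite -mulrN -mulNr opprB.
  case: ifPn => [|]; rewrite ?notin_setE ?inE/= in_itv/= => mx.
    rewrite max_l// lee_fin.
    by rewrite !mulr_ge0 ?normal_peak_ge0 ?normal_fun_ge0 ?subr_ge0.
  rewrite max_r// lee_fin mulr_ge0_le0 ?normal_peak_ge0//.
  rewrite mulr_le0_ge0 ?normal_fun_ge0//.
  by rewrite subr_le0 leNgt; apply/negP => /ltW.
- apply: measurable_funTS; apply/measurable_EFinP/measurable_funM.
    exact: measurable_funB.
  exact: measurable_normal_fun.
- move=> x; rewrite in_itv/= => mx.
  by rewrite lee_fin mulr_ge0 ?normal_fun_ge0 ?subr_ge0.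
- by rewrite lee_fin normal_peak_ge0.
Qed.

Let integrable_center_pdf m s : s != 0 ->
  mu.-integrable [set: R] (center_pdf m s).
Proof.
move=> s0; apply/integrableP; split; first exact: measurable_center_pdf.
rewrite -/(abse \o center_pdf m s) fune_abse ge0_integralD//.
- by rewrite center_pdf_pos// center_pdf_neg// -EFinD ltry.
- by apply: measurable_funepos; exact: measurable_center_pdf.
- by apply: measurable_funeneg; exact: measurable_center_pdf.
Qed.

Let mean_pdfE m s x : (x * normal_pdf m s x)%:E =
  (center_pdf m s x + m%:E * (normal_pdf m s x)%:E)%E.
Proof. by rewrite -EFinM -EFinD -mulrDl subrK. Qed.

Lemma integrable_normal_pdf_mean m s : s != 0 ->
  mu.-integrable [set: R] (fun x => (x * normal_pdf m s x)%:E).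
Proof.
move=> s0; under eq_fun do rewrite mean_pdfE.
apply: integrableD => //; first exact: integrable_center_pdf.
by apply: integrableZl => //; exact: integrable_normal_pdf.
Qed.

Lemma integral_normal_pdf_mean m s : s != 0 ->
  (\int[mu]_x (x * normal_pdf m s x)%:E = m%:E)%E.
Proof.
move=> s0.
have c0 : (\int[mu]_x center_pdf m s x = 0)%E.
  by rewrite integralE center_pdf_pos// center_pdf_neg// -EFinB subrr.
under eq_integral do rewrite mean_pdfE.
rewrite integralD//.
- rewrite c0 integralZl//; last exact: integrable_normal_pdf.
  by rewrite integral_normal_pdf mule1 add0e.
- exact: integrable_center_pdf.
- by apply: integrableZl => //; exact: integrable_normal_pdf.
Qed.

(** A crude bound of the variance is enough: (x - m)^2 times the Gaussian kernel
    of standard deviation s is dominated by the Gaussian kernel of standard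
    deviation sqrt 2 * s, of which the former is the square. *)
Lemma integral_normal_prob_sqr_le m s : s != 0 ->
  (\int[normal_prob m s]_x ((x - m) ^+ 2)%:E <=
   (s ^+ 2 *+ 4 * (normal_peak s / normal_peak (Num.sqrt 2 * s)))%:E)%E.
Proof.
move=> s0; set s' := Num.sqrt 2 * s.
have s2 : s' ^+ 2 = s ^+ 2 *+ 2.
  by rewrite exprMn sqr_sqrtr// mulr_natl.
have s'0 : s' != 0 by rewrite mulf_neq0// gt_eqF// sqrtr_gt0.
have nE x : normal_fun m s x = normal_fun m s' x ^+ 2.
  rewrite /normal_fun -expRM_natl; congr expR.
  by rewrite s2 -[(s ^+ 2 *+ 2) *+ 2]mulr_natr invfM -[in RHS]mulr_natl; field.
have m2 : measurable_fun [set: R] (fun x : R => (x - m) ^+ 2).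
  by apply: measurable_funX; exact: measurable_funB.
rewrite normal_prob_integral; last exact/measurable_EFinP.
apply: (@le_trans _ _ (\int[mu]_x
    ((s ^+ 2 *+ 4 * (normal_peak s / normal_peak s'))%:E *
     (normal_pdf m s' x)%:E))%E); last first.
  rewrite ge0_integralZl ?integral_normal_pdf ?mule1//.
  - by apply/measurable_EFinP; exact: measurable_normal_pdf.
  - by move=> x _; rewrite lee_fin normal_pdf_ge0.
  - by rewrite lee_fin mulr_ge0 ?mulrn_wge0 ?sqr_ge0 ?divr_ge0 ?normal_peak_ge0.
apply: ge0_le_integral => //.
- by move=> x _; rewrite mule_ge0 ?lee_fin ?sqr_ge0 ?normal_pdf_ge0.
- apply: emeasurable_funM; first exact/measurable_EFinP.
  by apply/measurable_EFinP; exact: measurable_normal_pdf.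
- apply: emeasurable_funM => //.
  by apply/measurable_EFinP; exact: measurable_normal_pdf.
- move=> x _; rewrite -!EFinM lee_fin !normal_pdfE// nE.
  have p0 : normal_peak s' != 0 by rewrite gt_eqF// normal_peak_gt0.
  have -> : s ^+ 2 *+ 4 * (normal_peak s / normal_peak s') *
      (normal_peak s' * normal_fun m s' x) =
      normal_peak s * normal_fun m s' x * (s' ^+ 2 *+ 2).
    by rewrite s2; field.
  have -> : (x - m) ^+ 2 * (normal_peak s * normal_fun m s' x ^+ 2) =
      normal_peak s * normal_fun m s' x * ((x - m) ^+ 2 * normal_fun m s' x).
    by ring.
  by rewrite ler_wpM2l ?mulr_ge0 ?normal_peak_ge0 ?normal_fun_ge0
    ?sqr_normal_fun_le.
Qed.

(** Beyond sqrt 2 * s the integrand is at most twice (x^2 - s^2) times the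
    Gaussian kernel, which has the antiderivative - 2 s^2 x times the
    kernel. *)
Lemma integral_sqr_normal_fun_tail (s z : R) : s != 0 -> 0 <= z ->
    s ^+ 2 *+ 2 <= z ^+ 2 ->
  (\int[mu]_(x in `[z, +oo[) (x ^+ 2 * normal_fun 0 s x)%:E <=
   (s ^+ 2 *+ 2 * (z * normal_fun 0 s z))%:E)%E.
Proof.
move=> s0 z0 sz; pose F x := - (s ^+ 2 *+ 2) * (x * normal_fun 0 s x).
pose f x := (x ^+ 2 - s ^+ 2) *+ 2 * normal_fun 0 s x.
have dF (x : R) : is_derive x 1 F (f x).
  have := is_derive_normal_fun 0 s x => dn.
  apply: is_derive_eq; rewrite /GRing.scale/= /f; field.
  by [].
have sqr_cont (x : R) : {for x, continuous (fun x : R => x ^+ 2)}.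
  exact: sqr_continuous.
have cf : continuous f.
  move=> x; apply: cvgM; last exact: continuous_normal_fun.
  by apply: cvgMn; apply: cvgB; [exact: sqr_cont|exact: cvg_cst].
have zx x : z <= x -> s ^+ 2 *+ 2 <= x ^+ 2.
  by move=> /(le_trans _) h; rewrite (le_trans sz)// ler_sqr ?nnegrE ?h//.
have f0 x : z <= x -> 0 <= f x.
  move=> /zx h; rewrite mulr_ge0 ?normal_fun_ge0// mulrn_wge0// subr_ge0.
  by rewrite (le_trans _ h)// mulr2n lerDl sqr_ge0.
have Fl : F x @[x --> +oo] --> 0.
  rewrite -(mulr0 (- (s ^+ 2 *+ 2))); apply: cvgMr.
  exact: mul_normal_fun_cvgy.
rewrite [leRHS](_ : _ = (0 - F z)%:E); last first.
  by rewrite /F sub0r mulNr opprK.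
rewrite -(ge0_integral_itvy_is_derive dF cf f0 Fl).
apply: ge0_le_integral => //.
- by move=> x _; rewrite lee_fin mulr_ge0 ?normal_fun_ge0 ?sqr_ge0.
- apply: measurable_funTS; apply/measurable_EFinP/measurable_funM => //.
  exact: measurable_normal_fun.
- apply: measurable_funTS; apply/measurable_EFinP.
  exact: continuous_measurable_fun.
- move=> x; rewrite /= in_itv/= andbT => /zx h.
  rewrite lee_fin ler_wpM2r ?normal_fun_ge0//.
  by rewrite mulrnBl lerBrDr mulr2n lerD2l.
Qed.

Lemma integral_sqr_normal_fun_ltail (s z : R) : s != 0 -> 0 <= z ->
    s ^+ 2 *+ 2 <= z ^+ 2 ->
  (\int[mu]_(x in `]-oo, (- z)%R]) (x ^+ 2 * normal_fun 0 s x)%:E <=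
   (s ^+ 2 *+ 2 * (z * normal_fun 0 s z))%:E)%E.
Proof.
move=> s0 z0 sz; rewrite ge0_integration_by_substitutionNy.
- apply: le_trans (integral_sqr_normal_fun_tail s0 z0 sz).
  apply/eq_leW/eq_integral => x _ /=.
  by rewrite /normal_fun !subr0 sqrrN.
- apply: continuous_subspaceT => x.
  by apply: cvgM; [exact: sqr_continuous|exact: continuous_normal_fun].
- by move=> x _; rewrite mulr_ge0 ?sqr_ge0 ?normal_fun_ge0.
Qed.

(** The integrand is at most (s^2 + x^2) exp (x^2 / (2 s^2)), the derivative of
    s^2 x exp (x^2 / (2 s^2)). *)
Lemma integral_sqr_expR_bulk (s z : R) : s != 0 -> 0 <= z ->
  (\int[mu]_(x in `[(- z)%R, z]) (x ^+ 2 * expR (x ^+ 2 / (s ^+ 2 *+ 2)))%:E <=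
   (s ^+ 2 *+ 2 * (z * expR (z ^+ 2 / (s ^+ 2 *+ 2))))%:E)%E.
Proof.
move=> s0 z0; pose h (x : R) : R := x ^+ 2 / (s ^+ 2 *+ 2).
pose F x := s ^+ 2 * (x * expR (h x)).
pose f x := (s ^+ 2 + x ^+ 2) * expR (h x).
have dh (x : R) : is_derive x 1 h (x / s ^+ 2).
  rewrite /h; apply: is_derive_eq.
  by rewrite /GRing.scale/=; field.
have de (x : R) : is_derive x 1 (expR \o h) (expR (h x) * (x / s ^+ 2)).
  exact: is_derive1_comp.
have dF (x : R) : is_derive x 1 F (f x).
  have := de x => dex.
  rewrite (_ : F = fun x => s ^+ 2 * (x * (expR \o h) x))//.
  apply: is_derive_eq; rewrite /GRing.scale/= /f; field.
  by [].
have ce : continuous (expR \o h).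
  move=> x; apply/differentiable_continuous/derivable1_diffP.
  exact: ex_derive.
have cf : continuous f.
  move=> x; apply: cvgM; last exact: ce.
  by apply: cvgD; [exact: cvg_cst|exact: sqr_continuous].
have zz : - z <= z by rewrite (le_trans _ z0)// oppr_le0.
rewrite [leRHS](_ : _ = (F z - F (- z))%:E); last first.
  by congr EFin; rewrite /F /h sqrrN; ring.
rewrite -(integral_itv_is_derive dF cf zz).
apply: ge0_le_integral => //.
- by move=> x _; rewrite lee_fin mulr_ge0 ?expR_ge0 ?sqr_ge0.
- apply: measurable_funTS; apply/measurable_EFinP/measurable_funM => //.
  exact: (continuous_measurable_fun ce).
- apply: measurable_funTS; apply/measurable_EFinP.
  exact: continuous_measurable_fun.
- move=> x _; rewrite lee_fin ler_wpM2r ?expR_ge0//.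
  by rewrite lerDr sqr_ge0.
Qed.

End gaussian.

(** * The posterior mean as a ratio of one-dimensional integrals *)

Section shrinkage.
Context (R : realType).
Local Notation mR := (measurableTypeR R).
Implicit Types (tau x l : R).

(** The weight that the conditional posterior mean given lambda = l puts on the
    prior mean 0; the weight of the observation is [1 - shrink tau l]. *)
Definition shrink tau l : R := (oneDsqr (tau * l))^-1.

(** With x = y^2 / (2 sigma^2), this is the density at y of the marginal law
    N(0, sigma^2 (1 + tau^2 l^2)) of the observation given lambda = l, up to the
    factor [normal_peak sigma]. *)
Definition mixing_weight tau x l : R :=
  Num.sqrt (shrink tau l) * expR (- (x * shrink tau l)).

Lemma oneDsqr_gt0 (z : R) : 0 < oneDsqr z.
Proof. by rewrite (lt_le_trans ltr01)// oneDsqr_ge1. Qed.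

Lemma shrink_gt0 tau l : 0 < shrink tau l.
Proof. by rewrite invr_gt0 oneDsqr_gt0. Qed.

Lemma shrink_le1 tau l : shrink tau l <= 1.
Proof. exact: oneDsqrV_le1. Qed.

Lemma shrink_ge0 tau l : 0 <= shrink tau l. Proof. exact/ltW/shrink_gt0. Qed.

Lemma continuous_shrink tau : continuous (shrink tau).
Proof.
move=> l; apply: (@continuous_comp _ _ _ ( *%R tau) (fun z => (oneDsqr z)^-1)).
  exact: mulrl_continuous.
exact: continuous_oneDsqrV.
Qed.

Lemma sqrt_shrink_le1 tau l : Num.sqrt (shrink tau l) <= 1.
Proof. by rewrite -[leRHS]sqrtr1 ler_sqrt// shrink_le1. Qed.

Lemma continuous_mixing_weight tau x : continuous (mixing_weight tau x).
Proof.
move=> l; apply: cvgM.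
  apply: (@continuous_comp _ _ _ (shrink tau) Num.sqrt).
    exact: continuous_shrink.
  exact: sqrt_continuous.
apply: (@continuous_comp _ _ _ (fun l => - (x * shrink tau l)) expR).
  by apply: cvgN; apply: cvgMr; exact: continuous_shrink.
exact: continuous_expR.
Qed.

Lemma mixing_weight_gt0 tau x l : 0 < mixing_weight tau x l.
Proof. by rewrite mulr_gt0 ?expR_gt0// sqrtr_gt0 shrink_gt0. Qed.

Lemma mixing_weight_ge0 tau x l : 0 <= mixing_weight tau x l.
Proof. exact/ltW/mixing_weight_gt0. Qed.

Lemma mixing_weight_le1 tau x l : 0 <= x -> mixing_weight tau x l <= 1.
Proof.
move=> x0; rewrite mulr_ile1 ?sqrtr_ge0 ?expR_ge0 ?sqrt_shrink_le1//.
by rewrite -[leRHS]expR0 ler_expR oppr_le0 mulr_ge0 ?shrink_ge0.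
Qed.

Lemma measurable_shrink tau : measurable_fun [set: R] (shrink tau).
Proof. by apply: continuous_measurable_fun; exact: continuous_shrink. Qed.

Lemma measurable_mixing_weight tau x :
  measurable_fun [set: R] (mixing_weight tau x).
Proof.
by apply: continuous_measurable_fun; exact: continuous_mixing_weight.
Qed.

Lemma bounded_integrable (mu : {finite_measure set mR -> \bar R}) (f : R -> R)
    (M : R) :
  measurable_fun [set: R] f -> (forall l, `|f l| <= M) ->
  mu.-integrable [set: mR] (EFin \o f).
Proof.
move=> mf fM; apply: measurable_bounded_integrable => //.
  by rewrite -ge0_fin_numE// fin_num_measure.
exists M; split; first exact: num_real.
by move=> N MN l _ /=; rewrite (le_trans (fM l))// ltW.
Qed.

Definition mixing_mass tau x : R :=
  \int[@half_cauchy R]_l mixing_weight tau x l.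

Definition shrunk_mass tau x : R :=
  \int[@half_cauchy R]_l (shrink tau l * mixing_weight tau x l).

Lemma integrable_mixing_weight tau x : 0 <= x ->
  (@half_cauchy R).-integrable [set: mR] (EFin \o mixing_weight tau x).
Proof.
move=> x0; apply: (@bounded_integrable _ _ 1).
  exact: measurable_mixing_weight.
by move=> l; rewrite ger0_norm ?mixing_weight_ge0// mixing_weight_le1.
Qed.

Lemma integrable_shrink_mixing_weight tau x : 0 <= x ->
  (@half_cauchy R).-integrable [set: mR]
    (EFin \o (fun l => shrink tau l * mixing_weight tau x l)).
Proof.
move=> x0; apply: (@bounded_integrable _ _ 1).
  apply: measurable_funM; first exact: measurable_shrink.
  exact: measurable_mixing_weight.
move=> l; rewrite ger0_norm ?mulr_ge0 ?mixing_weight_ge0 ?shrink_ge0//.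
by rewrite mulr_ile1 ?mixing_weight_ge0 ?shrink_ge0 ?mixing_weight_le1
  ?shrink_le1.
Qed.

Lemma half_cauchy_pdf_le0 l : l <= 0 -> half_cauchy_pdf l = 0.
Proof.
move=> l0; rewrite /half_cauchy_pdf patchE ifN// notin_setE/= in_itv/= andbT.
by apply/negP; rewrite -leNgt.
Qed.

Lemma half_cauchy_integral (f : R -> \bar R) : measurable_fun [set: R] f ->
  (\int[@half_cauchy R]_l f l =
   \int[lebesgue_measure]_l (f l * (half_cauchy_pdf l)%:E))%E.
Proof.
move=> mf; apply: integral_density => //.
- exact: measurable_half_cauchy_pdf.
- exact: half_cauchy_pdf_ge0.
Qed.

(** The half-Cauchy density vanishes outside the positive reals; in particular
    the degenerate scale lambda = 0 is irrelevant. *)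
Lemma eq_half_cauchy_integral (f g : R -> \bar R) :
  measurable_fun [set: R] f -> measurable_fun [set: R] g ->
  (forall l, 0 < l -> f l = g l) ->
  (\int[@half_cauchy R]_l f l = \int[@half_cauchy R]_l g l)%E.
Proof.
move=> mf mg fg; rewrite !half_cauchy_integral//; apply: eq_integral => l _.
have [l0|l0] := leP l 0; last by rewrite fg.
by rewrite half_cauchy_pdf_le0// !mule0.
Qed.

Lemma normal_pdfM (m s x : R) : s != 0 ->
  normal_pdf m s x = normal_peak s * normal_fun m s x.
Proof. by move=> s0; rewrite normal_pdfE. Qed.

Lemma normal_peakM (v c : R) : 0 < c -> normal_peak (v * c) = normal_peak v / c.
Proof.
move=> c0; rewrite /normal_peak.
have -> : (v * c) ^+ 2 * pi *+ 2 = (v ^+ 2 * pi *+ 2) * c ^+ 2 by ring.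
have v0 : 0 <= v ^+ 2 * pi *+ 2.
  by rewrite mulrn_wge0// mulr_ge0 ?sqr_ge0 ?pi_ge0.
by rewrite sqrtrM// sqrtr_sqr gtr0_norm// invfM.
Qed.

(** Conjugacy of the Gaussian family: likelihood times prior density of theta
    given lambda = l is the marginal density of y times the density of the
    conditional posterior, by completing the square in [t]. *)
Lemma normal_pdf_complete_square (sigma tau l y t : R) :
    0 < sigma -> 0 < tau -> 0 < l ->
  normal_pdf t sigma y * normal_pdf 0 (sigma * tau * l) t =
  normal_peak sigma * mixing_weight tau (y ^+ 2 / (sigma ^+ 2 *+ 2)) l *
  normal_pdf ((1 - shrink tau l) * y)
             (sigma * tau * l * Num.sqrt (shrink tau l)) t.
Proof.
move=> s0 t0 l0; have v0 : 0 < sigma * tau * l by rewrite !mulr_gt0.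
have q0 : 0 < Num.sqrt (shrink tau l) by rewrite sqrtr_gt0 shrink_gt0.
rewrite !normal_pdfM ?gt_eqF ?mulr_gt0// /mixing_weight.
rewrite (normal_peakM (sigma * tau * l) q0).
have -> : normal_peak sigma * normal_fun t sigma y *
    (normal_peak (sigma * tau * l) * normal_fun 0 (sigma * tau * l) t) =
    normal_peak sigma * normal_peak (sigma * tau * l) *
    (normal_fun t sigma y * normal_fun 0 (sigma * tau * l) t) by ring.
set q := Num.sqrt _; set m := normal_fun _ (_ * q) t.
have -> : forall e, normal_peak sigma * (q * e) *
    (normal_peak (sigma * tau * l) / q * m) =
    normal_peak sigma * normal_peak (sigma * tau * l) * (e * m).
  by move=> e; field; rewrite gt_eqF.
congr (_ * _); rewrite /m /normal_fun -!expRD; congr expR.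
rewrite [(_ * q) ^+ 2]exprMn /q sqr_sqrtr ?shrink_ge0// /shrink /oneDsqr.
field.
by rewrite !gt_eqF// ltr_pwDl// ?sqr_ge0//.
Qed.


Section posterior_mean.
Variables (sigma tau y : R).
Hypotheses (s0 : 0 < sigma) (t0 : 0 < tau).
Let x := y ^+ 2 / (sigma ^+ 2 *+ 2).
Let prior := horseshoe_prior sigma tau.

Let x0 : 0 <= x. Proof. by rewrite divr_ge0 ?mulrn_wge0 ?sqr_ge0. Qed.

Let measurable_likelihood : measurable_fun [set: mR]
  (fun t : mR => normal_pdf t sigma y).
Proof. by apply/measurable_EFinP; exact: measurable_normal_likelihood. Qed.

(** Here [e m] is the mean of [f] under a Gaussian law with mean [m], whatever
    its standard deviation. The instances [f = cst 1] and [f = id] give the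
    evidence and the numerator of the posterior mean. The bound [M] is what
    allows a signed [f]: it holds because the likelihood, as a function of the
    parameter, decays faster than [f] grows. *)
Lemma integral_prior_likelihood (f e : R -> R) (M : R) :
    measurable_fun [set: R] f -> measurable_fun [set: R] e ->
    (forall t, `|f t * normal_pdf t sigma y| <= M) ->
    (forall m s : R, s != 0 -> (@lebesgue_measure R).-integrable [set: R]
       (fun t => (f t * normal_pdf m s t)%:E)) ->
    (forall m s : R, s != 0 ->
       (\int[lebesgue_measure]_t (f t * normal_pdf m s t)%:E = (e m)%:E)%E) ->
  (\int[prior]_t (f t * normal_pdf t sigma y)%:E =
   \int[@half_cauchy R]_l (normal_peak sigma *
     (e ((1 - shrink tau l) * y)%R * mixing_weight tau x l))%:E)%E.
Proof.
move=> mf me fM fint fe.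
have mfl : measurable_fun [set: R] (fun t => (f t * normal_pdf t sigma y)%:E).
  by apply/measurable_EFinP/measurable_funM.
rewrite /prior /horseshoe_prior.
rewrite (@integral_giry_bind_bounded _ _ _ _ _ _ _ _ _ M)//.
apply: eq_half_cauchy_integral.
- by apply: measurable_integral_giry => //; exact: measurable_normal_scale.
- apply/measurable_EFinP/measurable_funM => //.
  apply: measurable_funM; last exact: measurable_mixing_weight.
  apply: (measurableT_comp me); apply: measurable_funM => //.
  by apply: measurable_funB => //; exact: measurable_shrink.
- move=> l l0; rewrite normal_prob_integral//.
  transitivity (\int[lebesgue_measure]_t
      ((normal_peak sigma * mixing_weight tau x l)%:E *
       (f t * normal_pdf ((1 - shrink tau l) * y)
          (sigma * tau * l * Num.sqrt (shrink tau l)) t)%:E))%E.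
    apply: eq_integral => t _; rewrite -!EFinM; congr EFin.
    by rewrite -[LHS]mulrA normal_pdf_complete_square// mulrCA.
  rewrite integralZl//=; last first.
    by apply: fint; rewrite gt_eqF// !mulr_gt0 ?sqrtr_gt0 ?shrink_gt0.
  rewrite fe; last by rewrite gt_eqF// !mulr_gt0 ?sqrtr_gt0 ?shrink_gt0.
  by rewrite -EFinM -mulrA (mulrC (mixing_weight _ _ _)).
Qed.

Lemma horseshoe_weight_setT : horseshoe_weight sigma tau y [set: mR] =
  (normal_peak sigma * mixing_mass tau x)%:E.
Proof.
rewrite /horseshoe_weight.
under eq_integral do rewrite -[normal_pdf _ _ _]mul1r.
rewrite (@integral_prior_likelihood (cst 1) (cst 1) (normal_peak sigma))//.
- under eq_integral do rewrite mul1r EFinM.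
  rewrite integralZl//; last exact: integrable_mixing_weight.
  rewrite EFinM; congr (_ * _)%E; rewrite /mixing_mass /Rintegral fineK//.
  by apply: integrable_fin_num => //; exact: integrable_mixing_weight.
- move=> t; rewrite mul1r ger0_norm ?normal_pdf_ge0//.
  by rewrite normal_pdf_ub// gt_eqF.
- move=> m s s'0; under eq_fun do rewrite mul1r.
  exact: integrable_normal_pdf.
- move=> m s s'0; under eq_integral do rewrite mul1r.
  exact: integral_normal_pdf.
Qed.

Lemma likelihood_moment_le t : `|t * normal_pdf t sigma y| <=
  normal_peak sigma * ((`|y| + 1) + sigma ^+ 2 *+ 2).
Proof.
rewrite normal_pdfM ?gt_eqF// normrM.
have p0 := normal_peak_ge0 sigma.
rewrite (ger0_norm (mulr_ge0 p0 (normal_fun_ge0 _ _ _))) mulrCA ler_wpM2l//.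
have h1 : normal_fun t sigma y <= 1.
  rewrite -[leRHS]expR0 ler_expR mulNr oppr_le0.
  by rewrite divr_ge0 ?mulrn_wge0 ?sqr_ge0.
have h2 := sqr_normal_fun_le t y (lt0r_neq0 s0).
have h3 : `|t| <= `|y| + 1 + (y - t) ^+ 2.
  rewrite -addrA -lerBlDl (le_trans (lerB_dist _ _))// distrC.
  rewrite -[(y - t) ^+ 2]real_normK ?num_real//.
  have := normr_ge0 (y - t); set u := `|_| => u0.
  have : 0 <= (u - 1) ^+ 2 by rewrite sqr_ge0.
  by nra.
have n0 := normal_fun_ge0 t sigma y.
rewrite (le_trans (ler_wpM2r n0 h3))// mulrDl lerD//.
by rewrite ler_piMr// addr_ge0.
Qed.

Lemma integral_prior_mean :
  (\int[prior]_t (t * normal_pdf t sigma y)%:E =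
   (normal_peak sigma * (y * (mixing_mass tau x - shrunk_mass tau x)))%:E)%E.
Proof.
have iK := integrable_mixing_weight tau x0.
have iS := integrable_shrink_mixing_weight tau x0.
rewrite (@integral_prior_likelihood id id
  (normal_peak sigma * ((`|y| + 1) + sigma ^+ 2 *+ 2)))//.
- transitivity (\int[@half_cauchy R]_l ((normal_peak sigma * y)%:E *
      (mixing_weight tau x l - shrink tau l * mixing_weight tau x l)%:E))%E.
    by apply: eq_integral => l _; rewrite -EFinM /=; congr EFin; ring.
  rewrite integralZl//; last first.
    by under eq_fun do rewrite EFinB; exact: integrableB.
  rewrite [RHS](_ : _ = (normal_peak sigma * y)%:E *
      (mixing_mass tau x - shrunk_mass tau x)%:E)%E; last first.
    by rewrite -EFinM mulrA.
  congr (_ * _)%E.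
  rewrite /mixing_mass /shrunk_mass -RintegralB// /Rintegral fineK//.
  apply: integrable_fin_num => //.
  by under eq_fun do rewrite EFinB; exact: integrableB.
- exact: likelihood_moment_le.
- by move=> m s s'0; exact: integrable_normal_pdf_mean.
- by move=> m s s'0; exact: integral_normal_pdf_mean.
Qed.

Lemma mixing_mass_gt0 : 0 < mixing_mass tau x.
Proof.
have /andP[+ _] := horseshoe_weight_fin tau y (lt0r_neq0 s0).
rewrite horseshoe_weight_setT lte_fin pmulr_rgt0//.
by rewrite normal_peak_gt0// gt_eqF.
Qed.

(** The posterior has the normalized likelihood as its density with respect to
    the prior, so its mean is the quotient of [integral_prior_mean] by
    [horseshoe_weight_setT]. *)
Lemma horseshoe_meanE :
  horseshoe_mean sigma tau y = y * (1 - shrunk_mass tau x / mixing_mass tau x).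
Proof.
have p0 : 0 < normal_peak sigma by rewrite normal_peak_gt0// gt_eqF.
have Q0 := mixing_mass_gt0.
set D := normal_peak sigma * mixing_mass tau x.
have D0 : 0 < D by rewrite mulr_gt0.
have postE A : measurable A -> horseshoe_posterior sigma tau y A =
    (\int[prior]_(t in A) (normal_pdf t sigma y / D)%:E)%E.
  move=> mA; transitivity (horseshoe_weight sigma tau y A *
      ((fine (horseshoe_weight sigma tau y [set: mR]))^-1)%:E)%E.
    have /andP[w0 wy] := horseshoe_weight_fin tau y (lt0r_neq0 s0).
    rewrite /horseshoe_posterior /= /mnormalize; case: ifPn => [/orP[] h|_ //].
      by move: w0; rewrite lt0e => /andP[/negP].
    by move: wy; rewrite lt_neqAle => /andP[/negP].
  rewrite horseshoe_weight_setT -/D.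
  rewrite /horseshoe_weight -ge0_integralZr//=.
  - apply: measurable_funTS; exact: measurable_normal_likelihood.
  - by move=> t _; rewrite lee_fin normal_pdf_ge0.
  - by rewrite lee_fin invr_ge0 ltW// mulr_gt0.
have mg : measurable_fun [set: mR] (fun t : mR => normal_pdf t sigma y / D).
  exact: measurable_funM.
have g0 t : 0 <= normal_pdf t sigma y / D.
  by rewrite divr_ge0 ?normal_pdf_ge0// ltW.
rewrite /horseshoe_mean unlock (integral_density mg g0 postE)//; last first.
  by apply/measurable_EFinP; exact: measurable_id.
transitivity (fine (\int[prior]_t
    ((t * normal_pdf t sigma y)%:E * (D^-1)%:E))%E).
  congr fine; apply: eq_integral => t _.
  by rewrite -!EFinM mulrA.
rewrite integralZr//; last first.
  apply: (@bounded_integrable _ (fun t => t * normal_pdf t sigma y)).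
    exact: measurable_funM.
  exact: likelihood_moment_le.
rewrite integral_prior_mean -EFinM /= /D.
by field; rewrite !gt_eqF.
Qed.

End posterior_mean.

End shrinkage.

(** * Bounds on the two integrals, uniform in the observation *)

Section kernel_bounds.
Context (R : realType).
Local Notation mR := (measurableTypeR R).
Local Notation mu := (@lebesgue_measure R).
Implicit Types (tau x l z L : R).

Lemma half_cauchy_pdfE l : 0 < l ->
  half_cauchy_pdf l = 2 / (pi * (1 + l ^+ 2)) :> R.
Proof.
by move=> l0; rewrite /half_cauchy_pdf patchE ifT// inE/= in_itv/= andbT.
Qed.

Lemma mixing_massE tau x : 0 <= x ->
  ((mixing_mass tau x)%:E =
   \int[@half_cauchy R]_l (mixing_weight tau x l)%:E)%E.
Proof.
move=> x0; rewrite /mixing_mass /Rintegral fineK//.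
by apply: integrable_fin_num => //; exact: integrable_mixing_weight.
Qed.

Lemma shrunk_mass_ge0 tau x : 0 <= shrunk_mass tau x.
Proof.
by apply: Rintegral_ge0 => l _; rewrite mulr_ge0 ?shrink_ge0 ?mixing_weight_ge0.
Qed.

Lemma shrunk_mass_le tau x : 0 <= x -> shrunk_mass tau x <= mixing_mass tau x.
Proof.
move=> x0; apply: le_Rintegral => //.
- exact: integrable_shrink_mixing_weight.
- exact: integrable_mixing_weight.
- by move=> l _; rewrite ler_piMl ?mixing_weight_ge0 ?shrink_le1.
Qed.

Lemma integral0y_shrink tau : 0 < tau ->
  (\int[mu]_(l in `[0%R, +oo[) (tau * shrink tau l)%:E = (pi / 2)%:E)%E.
Proof.
move=> t0; pose F l : R := atan (tau * l).
have dF (l : R) : is_derive l 1 F (tau * shrink tau l).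
  have dm : is_derive l 1 ( *%R tau) tau.
    by apply: is_derive_eq; rewrite /GRing.scale/= mulr1.
  by rewrite mulrC; exact: is_derive1_comp.
rewrite (ge0_integral_itvy_is_derive dF _ _ (l := pi / 2)).
- by rewrite /F mulr0 atan0 subr0.
- by move=> l; apply: cvgM; [exact: cvg_cst|exact: continuous_shrink].
- by move=> l _; rewrite mulr_ge0 ?shrink_ge0// ltW.
- have -> : F = atan \o (fun l => l * tau).
    by apply/funext => l; rewrite /F /= mulrC.
  have h : (l * tau) @[l --> +oo] --> +oo.
    by apply: gt0_cvgMly => //; exact: cvg_id.
  exact: (cvg_comp _ _ h (@cvgy_atan R)).
Qed.

Lemma onem_shrinkE tau l : 1 - shrink tau l = (tau * l) ^+ 2 * shrink tau l.
Proof.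
rewrite /shrink; have := oneDsqr_gt0 (tau * l); rewrite /oneDsqr => h.
by field; rewrite gt_eqF.
Qed.

(** Here 1 - s = tau^2 l^2 s, the weight is at most 1, and
    l^2 / (1 + l^2) <= 1; this leaves the Cauchy integral of
    (2 / pi) tau^2 / (1 + tau^2 l^2), which is equal to tau. *)
Lemma mixing_massB_le tau x : 0 < tau -> 0 <= x ->
  mixing_mass tau x - shrunk_mass tau x <= tau.
Proof.
move=> t0 x0.
have iK := integrable_mixing_weight tau x0.
have iS := integrable_shrink_mixing_weight tau x0.
rewrite /mixing_mass /shrunk_mass -RintegralB// -lee_fin /Rintegral.
rewrite fineK; last first.
  apply: integrable_fin_num => //.
  by under eq_fun do rewrite EFinB; exact: integrableB.
have mf : measurable_fun [set: R]
    (fun l =>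
      (mixing_weight tau x l - shrink tau l * mixing_weight tau x l)%:E).
  apply/measurable_EFinP/measurable_funB; first exact: measurable_mixing_weight.
  apply: measurable_funM; first exact: measurable_shrink.
  exact: measurable_mixing_weight.
rewrite half_cauchy_integral//.
have ms : measurable_fun [set: R] (fun l => (tau * shrink tau l)%:E).
  apply/measurable_EFinP/measurable_funM => //; exact: measurable_shrink.
have -> : tau%:E = (\int[mu]_(l in `[0%R, +oo[)
    ((tau * (2 / pi))%:E * (tau * shrink tau l)%:E))%E.
  rewrite ge0_integralZl//.
  - rewrite integral0y_shrink// -EFinM; congr EFin.
    by move: (pi : R) (pi_gt0 R) => q q0; field; rewrite gt_eqF.
  - exact: measurable_funTS.
  - by move=> l _; rewrite lee_fin mulr_ge0 ?shrink_ge0// ltW.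
  - by rewrite lee_fin mulr_ge0 ?divr_ge0 ?pi_ge0// ltW.
rewrite [leRHS]integral_mkcond.
have p0 := pi_gt0 R.
have K0 l : 0 <= mixing_weight tau x l - shrink tau l * mixing_weight tau x l.
  by rewrite subr_ge0 ler_piMl ?mixing_weight_ge0 ?shrink_le1.
apply: ge0_le_integral => //.
- by move=> l _; rewrite -EFinM lee_fin mulr_ge0 ?half_cauchy_pdf_ge0.
- apply: emeasurable_funM => //; apply/measurable_EFinP.
  exact: measurable_half_cauchy_pdf.
- apply/(measurable_restrictT _ _).1 => //; apply: measurable_funTS.
  exact: emeasurable_funM.
move=> l _; rewrite patchE -!EFinM; have [l0|l0] := leP l 0.
  rewrite half_cauchy_pdf_le0// mulr0.
  case: ifP => // _; rewrite lee_fin.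
  by rewrite !mulr_ge0 ?shrink_ge0 ?invr_ge0 ?pi_ge0 ?(ltW t0)//.
rewrite ifT; last by rewrite inE/= in_itv/= andbT ltW.
rewrite lee_fin half_cauchy_pdfE//.
have -> : mixing_weight tau x l - shrink tau l * mixing_weight tau x l =
    (1 - shrink tau l) * mixing_weight tau x l by ring.
have l2 : 0 < 1 + l ^+ 2 by rewrite ltr_pwDl// sqr_ge0.
rewrite onem_shrinkE.
have -> : (tau * l) ^+ 2 * shrink tau l * mixing_weight tau x l *
    (2 / (pi * (1 + l ^+ 2)))
   = (tau * (2 / pi)) * (tau * shrink tau l) *
     (mixing_weight tau x l * (l ^+ 2 / (1 + l ^+ 2))).
  by move: (pi : R) p0 => q q0; field; rewrite !gt_eqF.
rewrite ler_piMr//.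
  by rewrite !mulr_ge0 ?shrink_ge0 ?invr_ge0 ?pi_ge0 ?(ltW t0)//.
rewrite mulr_ile1 ?mixing_weight_ge0 ?mixing_weight_le1 ?divr_ge0 ?sqr_ge0
  ?(ltW l2)//.
by rewrite ler_pdivrMr// mul1r lerDr.
Qed.

(** The interval is open at [a] since the half-Cauchy density vanishes at 0, and
    [a = 0] is one of the two cases of interest. *)
Lemma mixing_mass_ge tau x a b k : 0 <= x -> 0 <= a -> a <= b -> 0 <= k ->
    (forall l, a < l <= b -> k <= mixing_weight tau x l) ->
  k * (2 / (pi * (1 + b ^+ 2))) * (b - a) <= mixing_mass tau x.
Proof.
move=> x0 a0 ab k0 kK; rewrite -lee_fin mixing_massE//.
rewrite half_cauchy_integral; last first.
  by apply/measurable_EFinP; exact: measurable_mixing_weight.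
set c := k * _.
have mf : measurable_fun [set: R]
    (fun l => (mixing_weight tau x l)%:E * (half_cauchy_pdf l)%:E)%E.
  apply: emeasurable_funM; apply/measurable_EFinP.
    exact: measurable_mixing_weight.
  exact: measurable_half_cauchy_pdf.
have f0 l : (0 <= (mixing_weight tau x l)%:E * (half_cauchy_pdf l)%:E)%E.
  by rewrite -EFinM lee_fin mulr_ge0 ?mixing_weight_ge0 ?half_cauchy_pdf_ge0.
have sq1 (r : R) : 0 < 1 + r ^+ 2 by rewrite ltr_pwDl// sqr_ge0.
have c0 : 0 <= c.
  by rewrite mulr_ge0// divr_ge0// mulr_ge0 ?pi_ge0// ltW.
apply: (@le_trans _ _ (\int[mu]_(l in `]a, b])
    ((mixing_weight tau x l)%:E * (half_cauchy_pdf l)%:E))%E); last first.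
  by apply: ge0_subset_integral.
apply: (@le_trans _ _ (\int[mu]_(l in `]a, b]) c%:E)%E).
  rewrite integral_cst//= lebesgue_measure_itv/= lte_fin.
  case: ltP => [_|ba]; first by rewrite -EFinB -EFinM.
  have -> : b - a = 0 by apply/eqP; rewrite subr_eq0 eq_le ba ab.
  by rewrite mulr0 mule0.
apply: ge0_le_integral => //.
- exact: measurable_funTS.
- move=> l /=; rewrite in_itv/= => /andP[al lb].
  have l0 : 0 < l by rewrite (le_lt_trans a0).
  rewrite -EFinM lee_fin half_cauchy_pdfE// ler_pM ?kK ?al//.
    by rewrite divr_ge0// mulr_ge0 ?pi_ge0// ltW.
  rewrite ler_pM2l// lef_pV2 ?posrE ?mulr_gt0 ?pi_gt0// ler_pM2l ?pi_gt0//.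
  by rewrite lerD2l ler_sqr ?nnegrE ?(ltW l0) ?(le_trans a0 ab).
Qed.

(** Obtained from the scales in ]0, 1], on which s >= 1/2. *)
Lemma mixing_mass_ge_expR tau x : 0 < tau <= 1 -> 0 <= x ->
  expR (- x) / (2 * pi) <= mixing_mass tau x.
Proof.
move=> /andP[t0 t1] x0; have p0 := pi_gt0 R.
have -> : expR (- x) / (2 * pi) =
    (2^-1 * expR (- x)) * (2 / (pi * (1 + 1 ^+ 2))) * (1 - 0) :> R.
  by move: (pi : R) p0 => q q0; field; rewrite gt_eqF.
apply: (@mixing_mass_ge tau x 0 1 (2^-1 * expR (- x))) => //.
move=> l /andP[l0 l1].
have s2 : 2^-1 <= shrink tau l.
  have tl : (tau * l) ^+ 2 <= 1.
    by rewrite exprn_ile1// ?mulr_ge0 ?mulr_ile1// ltW.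
  by rewrite /shrink lef_pV2 ?posrE ?oneDsqr_gt0// /oneDsqr; lra.
rewrite /mixing_weight ler_pM ?expR_ge0//.
  rewrite (le_trans s2)// -[leLHS]sqr_sqrtr ?shrink_ge0// expr2.
  by rewrite ler_piMr ?sqrtr_ge0 ?sqrt_shrink_le1.
by rewrite ler_expR lerN2 ler_piMr// shrink_le1.
Qed.

(** For a large observation the bulk of the mixing mass is at scales lambda of
    order z / tau. Between z / tau and 2 z / tau the exponent z^2 s is at most 1
    and s >= 1 / (9 z^2), while the half-Cauchy density is of order
    (tau / z)^2. *)
Lemma mixing_mass_ge_tail tau z : 0 < tau <= 1 -> 1 <= z ->
  2 / (15 * expR 1 * pi) * (tau / z ^+ 2) <= mixing_mass tau (z ^+ 2).
Proof.
move=> /andP[t0 t1] z1; have p0 := pi_gt0 R; have e0 := expR_gt0 (1 : R).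
have z0 : 0 < z by rewrite (lt_le_trans ltr01).
have z2 : 1 <= z ^+ 2 by rewrite exprn_ege1.
have tz : 0 < tau / z by rewrite divr_gt0.
apply: le_trans (@mixing_mass_ge tau (z ^+ 2) (z / tau) (2 * z / tau)
  (expR (- 1) / (3 * z)) _ _ _ _ _).
- have -> : 2 * z / tau - z / tau = z / tau by field; rewrite gt_eqF.
  rewrite expRN.
  have h : 1 + (2 * z / tau) ^+ 2 <= 5 * z ^+ 2 / tau ^+ 2.
    rewrite ler_pdivlMr ?exprn_gt0//.
    have -> : (1 + (2 * z / tau) ^+ 2) * tau ^+ 2 = tau ^+ 2 + 4 * z ^+ 2.
      by field; rewrite gt_eqF.
    have : tau ^+ 2 <= 1 by rewrite exprn_ile1// ltW.
    by lra.
  apply: (@le_trans _ _ ((expR 1)^-1 / (3 * z) *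
     (2 / (pi * (5 * z ^+ 2 / tau ^+ 2))) * (z / tau))).
    by apply: eq_leW; move: (pi : R) p0 => q q0; field; rewrite !gt_eqF.
  rewrite ler_pM2r ?divr_gt0// ler_pM2l ?divr_gt0 ?invr_gt0 ?mulr_gt0//.
  rewrite ler_pM2l// lef_pV2 ?posrE ?mulr_gt0 ?invr_gt0 ?exprn_gt0//.
    by rewrite ler_pM2l.
  by rewrite ltr_pwDl// sqr_ge0.
- by rewrite (le_trans ler01).
- by rewrite divr_ge0// ltW.
- by rewrite -mulrA ler_peMl ?ler1n// divr_ge0// ltW.
- by rewrite divr_ge0 ?expR_ge0// mulr_ge0// ltW.
move=> l /andP[zl lz].
have h1 : z <= tau * l by rewrite mulrC -ler_pdivrMr// ltW.
have h2 : tau * l <= 2 * z by rewrite mulrC -ler_pdivlMr.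
have h3 : z ^+ 2 <= (tau * l) ^+ 2.
  by rewrite ler_sqr ?nnegrE// ?(le_trans _ h1)// ltW.
have h4 : (tau * l) ^+ 2 <= 4 * z ^+ 2.
  rewrite [leRHS](_ : _ = (2 * z) ^+ 2); last by ring.
  by rewrite ler_sqr ?nnegrE// ?(le_trans _ h1)// ?mulr_ge0// ltW.
have D0 := oneDsqr_gt0 (tau * l).
rewrite /mixing_weight mulrC ler_pM ?invr_ge0 ?expR_ge0 ?mulr_ge0// ?(ltW z0)//.
- rewrite -[leLHS]ger0_norm ?invr_ge0 ?mulr_ge0// ?(ltW z0)//.
  rewrite -sqrtr_sqr ler_sqrt ?shrink_ge0// /shrink exprVn.
  rewrite lef_pV2 ?posrE// ?exprn_gt0 ?mulr_gt0// /oneDsqr exprMn.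
  by lra.
- rewrite ler_expR lerN2 /shrink ler_pdivrMr// mul1r /oneDsqr.
  by lra.
Qed.

(** Scales that shrink by at most [s] contribute at most [s] times the total
    mass, and for the others the exponential factor of the weight is at most
    exp (- x s). *)
Lemma shrunk_mass_split tau x s : 0 <= x -> 0 <= s ->
  shrunk_mass tau x <= s * mixing_mass tau x + expR (- (x * s)).
Proof.
move=> x0 s0; have iK := integrable_mixing_weight tau x0.
have -> : expR (- (x * s)) = \int[@half_cauchy R]_l expR (- (x * s)).
  rewrite Rintegral_cst// (_ : fine _ = 1) ?mulr1//.
  exact: (congr1 fine (@probability_setT _ _ _ (@half_cauchy R))).
have iC : (@half_cauchy R).-integrable [set: mR]
    (EFin \o (fun _ => expR (- (x * s)))).
  exact: finite_measure_integrable_cst.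
have iZ : (@half_cauchy R).-integrable [set: mR]
    (EFin \o (fun l => s * mixing_weight tau x l)).
  exact: (integrableZl measurableT s iK).
rewrite /mixing_mass -RintegralZl// -RintegralD//.
apply: le_Rintegral => //.
- exact: integrable_shrink_mixing_weight.
- exact: (integrableD measurableT iZ iC).
move=> l _; have K0 := mixing_weight_ge0 tau x l; have S0 := shrink_ge0 tau l.
have [ls|sl] := leP (shrink tau l) s.
  by rewrite (le_trans (ler_wpM2r K0 ls))// lerDl expR_ge0.
apply: (@le_trans _ _ (expR (- (x * s)))); last by rewrite lerDr mulr_ge0.
rewrite (le_trans (ler_piMl K0 (shrink_le1 tau l)))// /mixing_weight.
apply: (@le_trans _ _ (expR (- (x * shrink tau l)))).
  by rewrite ler_piMl ?expR_ge0 ?sqrt_shrink_le1.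
by rewrite ler_expR lerN2 ler_wpM2l// ltW.
Qed.

(** With z = |y| / (sigma sqrt 2) the left-hand side is |y - T(y)| in the same
    unit, so this is a bound on the bias towards 0 at a large observation. *)
Lemma shrunk_ratio_le L z : 0 <= L -> 1 <= z ->
  z * (shrunk_mass (expR (- L)) (z ^+ 2) / mixing_mass (expR (- L)) (z ^+ 2)) <=
  3 + L / z + 15 * expR 1 * pi / 2.
Proof.
move=> L0 z1; set tau := expR (- L).
have t0 : 0 < tau := expR_gt0 _.
have t1 : tau <= 1 by rewrite -[leRHS]expR0 ler_expR oppr_le0.
have p0 := pi_gt0 R; have e0 := expR_gt0 (1 : R).
have z0 : 0 < z by rewrite (lt_le_trans ltr01).
have lnz : 0 <= ln z by exact: ln_ge0.
(* The term 3 ln z makes exp (- z^2 s) equal to tau / z^3, which after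
   multiplication by z is of the order tau / z^2 of the lower bound of the
   mixing mass, however large z is compared with 1 / tau. *)
pose s := (3 * ln z + L) / z ^+ 2.
have s0 : 0 <= s by rewrite divr_ge0 ?sqr_ge0// addr_ge0// mulr_ge0.
have := mixing_mass_ge_tail (introT andP (conj t0 t1)) z1.
have := shrunk_mass_split tau (sqr_ge0 z) s0.
set S := shrunk_mass _ _; set Q := mixing_mass _ _.
have -> : expR (- (z ^+ 2 * s)) = tau / z ^+ 3.
  have -> : - (z ^+ 2 * s) = - L + - (ln z *+ 3).
    by rewrite /s -mulr_natl; field; rewrite gt_eqF.
  by rewrite expRD (expRN (ln z *+ 3)) -lnXn// lnK// posrE exprn_gt0.
set c := 2 / _ => hS hQ.
have c0 : 0 < c by rewrite divr_gt0// !mulr_gt0.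
have Q0 : 0 < Q by rewrite (lt_le_trans _ hQ)// mulr_gt0// divr_gt0// exprn_gt0.
rewrite mulrA ler_pdivrMr//.
apply: (@le_trans _ _ (z * s * Q + c^-1 * Q)).
  apply: (le_trans (ler_wpM2l (ltW z0) hS)); rewrite mulrDr mulrA lerD2l.
  rewrite ler_pdivlMl// (le_trans _ hQ)//.
  by apply: eq_leW; field; rewrite gt_eqF.
rewrite -mulrDl ler_pM2r// lerD//; last first.
  by apply: eq_leW; rewrite /c invf_div.
have -> : z * s = 3 * (ln z / z) + L / z by rewrite /s; field; rewrite gt_eqF.
rewrite lerD2r -[leRHS]mulr1 ler_pM2l// ler_pdivrMr// mul1r.
exact/ltW/ln_sublinear.
Qed.

End kernel_bounds.

(** * Risk in one coordinate, and its sum over coordinates *)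

Section measurability.
Context (R : realType).
Local Notation mR := (measurableTypeR R).
Variables (sigma tau : R).
Hypotheses (s0 : 0 < sigma) (t0 : 0 < tau).

Lemma measurable_half_cauchy_Rintegral (f : R -> R -> R) :
    measurable_fun [set: mR * mR] (fun z : mR * mR => f z.1 z.2) ->
    (forall x l, 0 <= f x l) ->
  measurable_fun [set: R] (fun x => \int[@half_cauchy R]_l f x l).
Proof.
move=> mf f0.
pose F (z : mR * mR) := (f z.1 z.2)%:E.
have mF : measurable_fun [set: mR] (fubini_F (@half_cauchy R) F).
  apply: measurable_fun_fubini_tonelli_F; first exact/measurable_EFinP.
  by move=> z; rewrite lee_fin.
exact: (measurableT_comp (fine_measurable _) mF).
Qed.

Let measurable_shrink2 :
  measurable_fun [set: mR * mR] (fun z : mR * mR => shrink tau z.2).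
Proof.
exact: (measurableT_comp (@measurable_shrink R tau) measurable_snd).
Qed.

Let measurable_mixing_weight2 :
  measurable_fun [set: mR * mR] (fun z : mR * mR => mixing_weight tau z.1 z.2).
Proof.
rewrite /mixing_weight; apply: measurable_funM.
  apply: (measurableT_comp _ measurable_shrink2).
  by apply: continuous_measurable_fun; exact: sqrt_continuous.
apply: (measurableT_comp (@measurable_expR R)).
apply: (measurableT_comp (@oppr_measurable R _)).
by apply: measurable_funM.
Qed.

Lemma measurable_mixing_mass : measurable_fun [set: R] (mixing_mass tau).
Proof.
by apply: measurable_half_cauchy_Rintegral => // x l; exact: mixing_weight_ge0.
Qed.

Lemma measurable_shrunk_mass : measurable_fun [set: R] (shrunk_mass tau).
Proof.
apply: (@measurable_half_cauchy_Rintegral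
  (fun x l => shrink tau l * mixing_weight tau x l)).
  exact: measurable_funM.
by move=> x l; rewrite mulr_ge0 ?shrink_ge0 ?mixing_weight_ge0.
Qed.

Lemma measurable_horseshoe_mean :
  measurable_fun [set: R] (horseshoe_mean sigma tau).
Proof.
pose x (y : R) : R := y ^+ 2 / (sigma ^+ 2 *+ 2).
have mx : measurable_fun [set: R] x.
  by apply: measurable_funM => //; exact: measurable_funX.
rewrite (_ : horseshoe_mean sigma tau = fun y =>
    y * (1 - shrunk_mass tau (x y) * (mixing_mass tau (x y)) `^ (-1))).
  apply: measurable_funM => //; apply: measurable_funB => //.
  apply: measurable_funM.
    exact: (measurableT_comp measurable_shrunk_mass).
  apply: (measurableT_comp (measurable_powR (-1))).
  exact: (measurableT_comp measurable_mixing_mass).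
apply/funext => y; rewrite horseshoe_meanE// powR_inv1//.
exact/ltW/mixing_mass_gt0.
Qed.

End measurability.

Section pointwise.
Context (R : realType).
Variables (sigma : R).
Hypotheses (s0 : 0 < sigma).

Lemma shrunk_ratio01 tau y : 0 < tau ->
  0 <= shrunk_mass tau (y ^+ 2 / (sigma ^+ 2 *+ 2)) /
       mixing_mass tau (y ^+ 2 / (sigma ^+ 2 *+ 2)) <= 1.
Proof.
move=> t0; set x := _ / _.
have x0 : 0 <= x by rewrite divr_ge0 ?mulrn_wge0 ?sqr_ge0.
have Q0 := mixing_mass_gt0 y s0 t0.
rewrite divr_ge0 ?shrunk_mass_ge0 ?(ltW Q0)//=.
by rewrite ler_pdivrMr// mul1r shrunk_mass_le.
Qed.

Lemma sqr_horseshoe_mean_le tau y : 0 < tau ->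
  horseshoe_mean sigma tau y ^+ 2 <= y ^+ 2.
Proof.
move=> t0; rewrite horseshoe_meanE// exprMn ler_piMr ?sqr_ge0//.
have /andP[r0 r1] := shrunk_ratio01 y t0.
by rewrite exprn_ile1// ?subr_ge0// lerBlDr lerDl.
Qed.

(** This is the quotient of [mixing_massB_le] by [mixing_mass_ge_expR]. *)
Lemma sqr_horseshoe_mean_le_expR tau y : 0 < tau <= 1 ->
  horseshoe_mean sigma tau y ^+ 2 <=
  (2 * pi * tau) ^+ 2 *
  (y ^+ 2 * expR (y ^+ 2 / (sigma ^+ 2 *+ 2)) ^+ 2).
Proof.
move=> /andP[t0 t1]; rewrite horseshoe_meanE//; have p0 := pi_gt0 R.
set x := y ^+ 2 / _; have x0 : 0 <= x by rewrite divr_ge0 ?mulrn_wge0 ?sqr_ge0.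
have Q0 : 0 < mixing_mass tau x := mixing_mass_gt0 y s0 t0.
have /andP[r0 r1] := shrunk_ratio01 y t0; rewrite -/x in r0 r1.
rewrite mulrCA exprMn ler_wpM2l ?sqr_ge0// -exprMn ler_sqr ?nnegrE ?subr_ge0//.
  have -> : 1 - shrunk_mass tau x / mixing_mass tau x =
      (mixing_mass tau x - shrunk_mass tau x) / mixing_mass tau x.
    by field; rewrite gt_eqF.
  rewrite ler_pdivrMr// (le_trans (mixing_massB_le t0 x0))//.
  have := mixing_mass_ge_expR (introT andP (conj t0 t1)) x0.
  rewrite expRN ler_pdivrMr ?mulr_gt0// mulrC => h.
  have e0 := expR_gt0 x.
  rewrite -[leLHS]mulr1.
  have -> : 2 * pi * tau * expR x * mixing_mass tau x =
     tau * (2 * pi * mixing_mass tau x * expR x) by ring.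
  by rewrite ler_pM2l// -ler_pdivrMr// div1r.
by rewrite !mulr_ge0 ?pi_ge0 ?expR_ge0// ltW.
Qed.

(** The comparison is between z = |y| / (sigma sqrt 2) and sqrt L: below it
    |y - T(y)| <= |y| is enough, above it L / z <= sqrt L in
    [shrunk_ratio_le]. *)
Lemma sqr_sub_horseshoe_mean_le L y : 1 <= L ->
  (y - horseshoe_mean sigma (expR (- L)) y) ^+ 2 <=
  sigma ^+ 2 *+ 2 * (4 + 15 * expR 1 * pi / 2) ^+ 2 * L.
Proof.
move=> L1; set tau := expR (- L); set c := 15 * _ * _ / _.
have t0 : 0 < tau := expR_gt0 _.
have L0 : 0 <= L by rewrite (le_trans ler01).
have c0 : 0 <= c by rewrite !mulr_ge0 ?expR_ge0 ?pi_ge0.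
have v0 : 0 < sigma ^+ 2 *+ 2 by rewrite mulrn_wgt0// exprn_gt0.
rewrite horseshoe_meanE//; set x := y ^+ 2 / _.
have x0 : 0 <= x by rewrite divr_ge0 ?mulrn_wge0 ?sqr_ge0.
have /andP[r0 r1] := shrunk_ratio01 y t0; rewrite -/x in r0 r1.
set r := _ / mixing_mass tau x in r0 r1 *.
have -> : (y - y * (1 - r)) ^+ 2 = sigma ^+ 2 *+ 2 * (Num.sqrt x * r) ^+ 2.
  rewrite exprMn sqr_sqrtr// mulrA [_ * x]mulrC /x divfK ?gt_eqF//; ring.
rewrite -mulrA ler_pM2l// -[X in _ <= _ * X](@sqr_sqrtr _ L)// -exprMn.
have sL0 := sqrtr_ge0 L.
have sL1 : 1 <= Num.sqrt L by rewrite -[leLHS]sqrtr1 ler_sqrt.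
have lhs0 : 0 <= Num.sqrt x * r by rewrite mulr_ge0 ?sqrtr_ge0.
have rhs0 : 0 <= (4 + c) * Num.sqrt L by rewrite mulr_ge0 ?addr_ge0.
rewrite ler_sqr ?nnegrE//.
have [xL|Lx] := leP (Num.sqrt x) (Num.sqrt L).
  apply: (@le_trans _ _ (Num.sqrt x)); first by rewrite ler_piMr ?sqrtr_ge0.
  by apply: (le_trans xL); rewrite ler_peMl//; lra.
have z1 : 1 <= Num.sqrt x by rewrite (le_trans sL1)// ltW.
have := shrunk_ratio_le L0 z1; rewrite sqr_sqrtr// -/tau -/r -/c.
move=> /le_trans; apply.
have : L / Num.sqrt x <= Num.sqrt L.
  rewrite ler_pdivrMr ?(lt_le_trans ltr01)// -[leLHS](@sqr_sqrtr _ L)// expr2.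
  by rewrite ler_wpM2l// ltW.
nra.
Qed.

End pointwise.

Section coordinate_risk.
Context (R : realType).
Local Notation mu := (@lebesgue_measure R).
Variables (sigma : R).
Hypotheses (s0 : 0 < sigma).

Let gap := sigma ^+ 2 *+ 2 * (4 + 15 * expR 1 * pi / 2) ^+ 2.
Let var :=
  sigma ^+ 2 *+ 4 * (normal_peak sigma / normal_peak (Num.sqrt 2 * sigma)).

Let coordinate_risk_gap_var L theta : 1 <= L ->
  (\int[normal_prob theta sigma]_y
     ((horseshoe_mean sigma (expR (- L)) y - theta) ^+ 2)%:E <=
   ((gap *+ 2 + var *+ 2) * L)%:E)%E.
Proof.
move=> L1; have t0 : 0 < expR (- L) := expR_gt0 _.
have b0 : 0 <= gap by rewrite mulr_ge0 ?sqr_ge0// mulrn_wge0// sqr_ge0.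
have v0 : 0 <= var.
  by rewrite mulr_ge0 ?mulrn_wge0 ?sqr_ge0// divr_ge0 ?normal_peak_ge0.
have L0 : 0 <= L by rewrite (le_trans ler01).
have m2 : measurable_fun [set: R] (fun y : R => (y - theta) ^+ 2).
  by apply: measurable_funX; exact: measurable_funB.
apply: (@le_trans _ _ (\int[normal_prob theta sigma]_y
    ((gap *+ 2 * L)%:E + 2%:E * ((y - theta) ^+ 2)%:E))%E).
  apply: ge0_le_integral => //.
  - by move=> y _; rewrite lee_fin sqr_ge0.
  - apply/measurable_EFinP/measurable_funX/measurable_funB => //.
    exact: measurable_horseshoe_mean.
  - apply: emeasurable_funD => //; apply: emeasurable_funM => //.
    exact/measurable_EFinP.
  - move=> y _; rewrite -EFinM -EFinD lee_fin.
    have := sqr_sub_horseshoe_mean_le s0 y L1; rewrite -/gap.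
    set T := horseshoe_mean _ _ _ => h.
    have : 0 <= ((T - y) - (y - theta)) ^+ 2 by rewrite sqr_ge0.
    nra.
rewrite ge0_integralD//; last 3 first.
- by move=> y _; rewrite lee_fin mulr_ge0// mulrn_wge0.
- by move=> y _; rewrite -EFinM lee_fin mulr_ge0// sqr_ge0.
- by apply: emeasurable_funM => //; exact/measurable_EFinP.
rewrite integral_cst// ge0_integralZl//; last 2 first.
- exact/measurable_EFinP.
- by move=> y _; rewrite lee_fin sqr_ge0.
apply: (@le_trans _ _ ((gap *+ 2 * L)%:E * 1 + 2%:E * var%:E)%E).
  apply: leeD.
    by rewrite lee_wpmul2l ?lee_fin ?mulr_ge0 ?mulrn_wge0// probability_le1.
  by rewrite lee_wpmul2l// integral_normal_prob_sqr_le// gt_eqF.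
rewrite mule1 -EFinM -EFinD lee_fin.
have : var <= var * L by rewrite ler_peMr.
by move: gap var => b v; lra.
Qed.

(** The loss is at most 2 (T(y) - y)^2 + 2 (y - theta)^2. *)
Lemma coordinate_risk_le : exists2 A, 0 < A & forall L theta, 1 <= L ->
  (\int[normal_prob theta sigma]_y
     ((horseshoe_mean sigma (expR (- L)) y - theta) ^+ 2)%:E <=
   (A * L)%:E)%E.
Proof.
exists (gap *+ 2 + var *+ 2); last exact: coordinate_risk_gap_var.
rewrite addr_gt0// mulrn_wgt0// mulr_gt0 ?mulrn_wgt0 ?exprn_gt0//.
  by rewrite addr_gt0// !mulr_gt0 ?expR_gt0 ?pi_gt0.
rewrite divr_gt0// normal_peak_gt0 ?gt_eqF//.
by rewrite mulr_gt0// sqrtr_gt0.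
Qed.

Let noise := normal_peak sigma * (sigma ^+ 2 *+ 2 * (sigma * Num.sqrt 2)) *
  ((2 * pi) ^+ 2 + 2).

(** The threshold zeta = sigma sqrt (2 L) balances the two bounds of T: at
    |y| = zeta the Gaussian kernel is equal to tau, and the growing factor
    exp (y^2 / (2 sigma^2)) is equal to 1 / tau. *)
Let coordinate_risk0_noise L : 1 <= L ->
  (\int[normal_prob 0 sigma]_y
     ((horseshoe_mean sigma (expR (- L)) y - 0) ^+ 2)%:E <=
   (noise * (expR (- L) * Num.sqrt L))%:E)%E.
Proof.
move=> L1; set tau := expR (- L).
have t0 : 0 < tau := expR_gt0 _.
have L0 : 0 <= L by rewrite (le_trans ler01).
have t1 : tau <= 1 by rewrite -[leRHS]expR0 ler_expR oppr_le0.
have sn0 : sigma != 0 by rewrite gt_eqF.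
have v0 : 0 < sigma ^+ 2 *+ 2 by rewrite mulrn_wgt0// exprn_gt0.
pose zeta := sigma * Num.sqrt 2 * Num.sqrt L.
have z0 : 0 <= zeta by rewrite !mulr_ge0 ?sqrtr_ge0// ltW.
have z2 : zeta ^+ 2 = sigma ^+ 2 *+ 2 * L.
  by rewrite !exprMn !sqr_sqrtr// mulr_natr.
have zL : zeta ^+ 2 / (sigma ^+ 2 *+ 2) = L.
  by rewrite z2 mulrAC divff ?mul1r ?gt_eqF.
have sz : sigma ^+ 2 *+ 2 <= zeta ^+ 2 by rewrite z2 ler_peMr// ltW.
have nz : normal_fun 0 sigma zeta = tau by rewrite /normal_fun subr0 mulNr zL.
have p0 := normal_peak_ge0 sigma.
pose T := horseshoe_mean sigma tau.
have mT : measurable_fun [set: R] T by exact: measurable_horseshoe_mean.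
pose h (y : R) := (T y ^+ 2 * normal_pdf 0 sigma y)%:E.
have mh : measurable_fun [set: R] h.
  apply/measurable_EFinP/measurable_funM; first exact: measurable_funX.
  exact: measurable_normal_pdf.
have h0 y : (0 <= h y)%E by rewrite lee_fin mulr_ge0 ?sqr_ge0 ?normal_pdf_ge0.
have hle y :
    (h y <= (normal_peak sigma)%:E * (y ^+ 2 * normal_fun 0 sigma y)%:E)%E.
  rewrite -EFinM lee_fin normal_pdfM// mulrCA ler_wpM2l//.
  by rewrite ler_wpM2r ?normal_fun_ge0// sqr_horseshoe_mean_le.
have mn : measurable_fun [set: R]
    (fun y : R => (y ^+ 2 * normal_fun 0 sigma y)%:E).
  by apply/measurable_EFinP/measurable_funM => //; exact: measurable_normal_fun.
have n0 y : (0 <= (y ^+ 2 * normal_fun 0 sigma y)%:E)%E.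
  by rewrite lee_fin mulr_ge0 ?sqr_ge0 ?normal_fun_ge0.
rewrite normal_prob_integral; last first.
  by apply/measurable_EFinP/measurable_funX/measurable_funB.
have -> : (\int[mu]_x (((T x - 0) ^+ 2)%:E * (normal_pdf 0 sigma x)%:E) =
    \int[mu]_x h x)%E.
  by apply: eq_integral => y _; rewrite subr0.
have mid : (\int[mu]_(x in `[(- zeta)%R, zeta]) h x <=
    (normal_peak sigma * (2 * pi * tau) ^+ 2)%:E *
      (sigma ^+ 2 *+ 2 * (zeta * tau^-1))%:E)%E.
  pose e (y : R) : R := y ^+ 2 * expR (y ^+ 2 / (sigma ^+ 2 *+ 2)).
  have me : measurable_fun [set: R] (fun y => (e y)%:E).
    apply/measurable_EFinP/measurable_funM => //.
    by apply: measurableT_comp => //; apply: measurable_funM.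
  have e0 y : (0 <= (e y)%:E)%E by rewrite lee_fin mulr_ge0 ?sqr_ge0 ?expR_ge0.
  have c0 : 0 <= normal_peak sigma * (2 * pi * tau) ^+ 2.
    by rewrite mulr_ge0 ?sqr_ge0.
  apply: (@le_trans _ _ (\int[mu]_(x in `[(- zeta)%R, zeta])
      ((normal_peak sigma * (2 * pi * tau) ^+ 2)%:E * (e x)%:E))%E).
    apply: ge0_le_integral => //; first exact: measurable_funTS.
      by apply: measurable_funTS; exact: emeasurable_funM.
    move=> y _; rewrite -EFinM lee_fin normal_pdfM//.
    rewrite -[leRHS]mulrA [leLHS]mulrCA ler_wpM2l//.
    have /(ler_wpM2r (normal_fun_ge0 0 sigma y)) :=
      sqr_horseshoe_mean_le_expR s0 y (introT andP (conj t0 t1)).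
    have nE : expR (y ^+ 2 / (sigma ^+ 2 *+ 2)) * normal_fun 0 sigma y = 1.
      by rewrite /normal_fun subr0 mulNr expRN divff// gt_eqF// expR_gt0.
    move/le_trans; apply; apply: eq_leW.
    transitivity ((2 * pi * tau) ^+ 2 * e y *
        (expR (y ^+ 2 / (sigma ^+ 2 *+ 2)) * normal_fun 0 sigma y)).
      by rewrite /e; move: (pi : R) (expR _) (normal_fun _ _ _) => a b c; ring.
    by rewrite nE mulr1.
  rewrite ge0_integralZl//; last exact: measurable_funTS.
  rewrite lee_wpmul2l ?lee_fin//.
  have := integral_sqr_expR_bulk sn0 z0.
  by rewrite zL -[expR L]invrK -expRN.
have tl (A : set R) : measurable A ->
    (\int[mu]_(x in A) (x ^+ 2 * normal_fun 0 sigma x)%:E <=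
      (sigma ^+ 2 *+ 2 * (zeta * tau))%:E)%E ->
    (\int[mu]_(x in A) h x <=
      (normal_peak sigma)%:E * (sigma ^+ 2 *+ 2 * (zeta * tau))%:E)%E.
  move=> mA hA; apply: (@le_trans _ _ (\int[mu]_(x in A)
      ((normal_peak sigma)%:E * (x ^+ 2 * normal_fun 0 sigma x)%:E))%E).
    apply: ge0_le_integral => //; first exact: measurable_funTS.
    by apply: measurable_funTS; exact: emeasurable_funM.
  rewrite ge0_integralZl//; last exact: measurable_funTS.
  by rewrite lee_wpmul2l// lee_fin.
have := integral_sqr_normal_fun_tail sn0 z0 sz.
rewrite nz => /(tl _ (measurable_itv _)) right.
have := integral_sqr_normal_fun_ltail sn0 z0 sz.
rewrite nz => /(tl _ (measurable_itv _)) left.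
set I0 := `[(- zeta)%R, zeta]%classic in mid.
set I1 := [set` _] in right.
set I2 := [set` _] in left.
have mI0 : measurable I0 by exact: measurable_itv.
have mI1 : measurable I1 by exact: measurable_itv.
have mI2 : measurable I2 by exact: measurable_itv.
have mr (A : set R) : measurable A -> measurable_fun [set: R] (h \_ A).
  move=> mA; apply/(measurable_restrictT _ _).1 => //.
  exact: measurable_funTS.
have r0 (A : set R) y : (0 <= (h \_ A) y)%E by exact: erestrict_ge0.
apply: (@le_trans _ _ (\int[mu]_y
    ((h \_ I0) y + ((h \_ I1) y + (h \_ I2) y)))%E).
  apply: ge0_le_integral => //.
    by apply: emeasurable_funD; [exact: mr|apply: emeasurable_funD; exact: mr].
  move=> y _.
  have [yz|zy] := leP y zeta; last first.
    have y1 : y \in I1 by rewrite inE /I1/= in_itv/= andbT ltW.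
    by rewrite [X in (_ + (X + _))%E]patchE y1 -[leLHS]add0e leeD// leeDl.
  have [zy|yz'] := leP (- zeta) y.
    have y0 : y \in I0 by rewrite inE /I0/= in_itv/= zy yz.
    by rewrite [X in (X + _)%E]patchE y0 leeDl// adde_ge0.
  have y2 : y \in I2 by rewrite inE /I2/= in_itv/= ltW.
  by rewrite [X in (_ + (_ + X))%E]patchE y2 addeA leeDr// adde_ge0.
rewrite ge0_integralD//; last 3 first.
- exact: mr.
- by move=> y _; rewrite adde_ge0.
- by apply: emeasurable_funD; exact: mr.
rewrite ge0_integralD//; last 2 first.
- exact: mr.
- exact: mr.
rewrite -!integral_mkcond.
apply: (le_trans (leeD mid (leeD right left))).
rewrite -!EFinM -!EFinD lee_fin /noise /zeta; apply: eq_leW.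
move: (pi : R) (Num.sqrt L) (Num.sqrt 2) (normal_peak sigma) => a b c d.
by field; rewrite gt_eqF.
Qed.

Lemma coordinate_risk0_le : exists2 B, 0 < B & forall L, 1 <= L ->
  (\int[normal_prob 0 sigma]_y
     ((horseshoe_mean sigma (expR (- L)) y - 0) ^+ 2)%:E <=
   (B * (expR (- L) * Num.sqrt L))%:E)%E.
Proof.
exists noise; last exact: coordinate_risk0_noise.
rewrite mulr_gt0 ?mulr_gt0 ?mulrn_wgt0 ?exprn_gt0 ?sqrtr_gt0//.
  by rewrite normal_peak_gt0// gt_eqF.
by rewrite addr_gt0// exprn_gt0// mulr_gt0 ?pi_gt0.
Qed.

End coordinate_risk.

Section risk.
Context (R : realType).
Local Notation mR := (measurableTypeR R).

(** The squared norm is a sum of functions of one coordinate each, and the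
    coordinates of the observation have the laws N(theta_i, sigma^2). *)
Lemma horseshoe_riskE (sigma tau : R) n (theta : n.-tuple mR) :
    0 < sigma -> 0 < tau ->
  ('E_(normal_vector sigma theta)
      [(fun Y => euclidean_norm
          (fun i => tnth (horseshoe_estimator sigma tau Y) i
                    - tnth theta i : R) ^+ 2)%R] =
   \sum_(i < n) \int[normal_prob (tnth theta i) sigma]_y
      ((horseshoe_mean sigma tau y - tnth theta i) ^+ 2)%:E)%E.
Proof.
move=> s0 t0; rewrite unlock.
pose g (i : 'I_n) (y : mR) :=
  ((horseshoe_mean sigma tau y - tnth theta i) ^+ 2)%:E.
have mg i : measurable_fun [set: mR] (g i).
  apply/measurable_EFinP/measurable_funX/measurable_funB => //.
  exact: measurable_horseshoe_mean.
have g0 i y : (0 <= g i y)%E by rewrite lee_fin sqr_ge0.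
transitivity (\int[normal_vector sigma theta]_Y \sum_(i < n) g i (tnth Y i))%E.
  apply: eq_integral => Y _; rewrite /g sumEFin; congr EFin.
  rewrite /euclidean_norm sqr_sqrtr; last first.
    by apply: sumr_ge0 => i _; rewrite sqr_ge0.
  by apply: eq_bigr => i _; rewrite tnth_mktuple.
rewrite ge0_integral_sum//.
- by apply: eq_bigr => i _; exact: ge0_integral_normal_vector_tnth.
- by move=> i; apply: (measurableT_comp (mg i)); exact: measurable_tnth.
Qed.

End risk.

Theorem theorem3p1 (R : realType) (sigma : R) (p : nat -> nat) (tau : nat -> R)
    (sigma_gt0 : 0 < sigma)
    (p_le : forall n, (p n <= n)%N)
    (p_cvg : p @ \oo --> \oo)
    (p_small : (fun n => (p n)%:R : R) =o_\oo (fun n => n%:R : R))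
    (tau_itv : forall n, 0 < tau n < 1)
    (tau_cvg : tau @ \oo --> 0) :
  exists2 c : R, 0 < c & \forall n \near \oo,
    (ereal_sup
       [set 'E_(normal_vector sigma theta0)
              [(fun Y => euclidean_norm
                  (fun i => tnth (horseshoe_estimator sigma (tau n) Y) i
                            - tnth theta0 i : R) ^+ 2)%R]
       | theta0 in nearly_black R n (p n)]
     <= (c * ((p n)%:R * ln (1 / tau n)
              + (n - p n)%:R * tau n * Num.sqrt (ln (1 / tau n))))%R%:E)%E.
Proof.
have [A A0 riskA] := coordinate_risk_le sigma_gt0.
have [B B0 riskB] := coordinate_risk0_le sigma_gt0.
exists (A + B); first exact: addr_gt0.
near=> n; apply: ge_ereal_sup => _ [theta sparse <-].
have /andP[t0 t1] := tau_itv n.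
set L := ln (1 / tau n).
have tauE : tau n = expR (- L).
  by rewrite /L div1r lnV ?posrE// opprK lnK ?posrE.
have L1 : 1 <= L.
  rewrite -[L]opprK lerNr -ler_expR -tauE ltW//.
  near: n.
  move/cvgrPdist_lt : tau_cvg => /(_ _ (expR_gt0 (-1))); apply: filterS => m.
  by rewrite sub0r normrN; apply: le_lt_trans; exact: ler_norm.
rewrite horseshoe_riskE// tauE.
pose nz := [pred i | (tnth theta i : R) != 0].
set t := expR (- L) * Num.sqrt L.
apply: (@le_trans _ _ (\sum_(i < n) (if nz i then A * L else B * t)%:E)%E).
  apply: lee_sum => i _; case: ifPn => [_|/negPn/eqP ->]; first exact: riskA.
  exact: riskB.
rewrite sumEFin lee_fin big_if/=.
rewrite !sumr_const -[X in A * L *+ X]/#|nz|.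
set nonnull := #|nz|; rewrite -[X in B * t *+ X]/#|[predC nz]|.
have -> : #|[predC nz]| = (n - nonnull)%N.
  by rewrite -[X in (X - _)%N](card_ord n) -(cardC nz) addKn.
have nonnull_le : (nonnull <= p n)%N by [].
rewrite -mulrA -/t -(mulr_natr (A * L)) -(mulr_natr (B * t)).
rewrite !natrB ?(leq_trans nonnull_le)//.
have kp : nonnull%:R <= (p n)%:R :> R by rewrite ler_nat.
have pn : (p n)%:R <= n%:R :> R by rewrite ler_nat.
have k0 : 0 <= nonnull%:R :> R by [].
have L0 : 0 <= L by rewrite (le_trans ler01).
have t_ge0 : 0 <= t by rewrite mulr_ge0 ?expR_ge0 ?sqrtr_ge0.
(* This absorbs the zero coordinates in excess of [n - p n]. *)
have tL : t <= L.
  rewrite (@le_trans _ _ (Num.sqrt L))//.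
    by rewrite ler_piMl ?sqrtr_ge0// -tauE ltW.
  rewrite -[leRHS](@sqr_sqrtr _ L)// expr2 ler_peMr ?sqrtr_ge0//.
  by rewrite -[leLHS]sqrtr1 ler_sqrt.
move: (nonnull%:R) (p n)%:R n%:R kp pn k0 => k q N kq qN k0.
have h1 : A * L * k <= A * L * q by rewrite ler_wpM2l// mulr_ge0// ltW.
have h2 : B * ((q - k) * t) <= B * (q * L).
  rewrite ler_pM2l// ler_pM// ?subr_ge0//; lra.
have h3 : 0 <= A * ((N - q) * t).
  by rewrite mulr_ge0 ?(ltW A0)// mulr_ge0// subr_ge0.
have -> : A * L * k + B * t * (N - k) =
  A * L * k + (B * ((q - k) * t) + B * ((N - q) * t)) by ring.
have -> : (A + B) * (q * L + (N - q) * t) =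
  (A * L * q + A * ((N - q) * t)) + (B * (q * L) + B * ((N - q) * t)) by ring.
by rewrite lerD// ?lerD2r// (le_trans h1)// lerDl.
Unshelve. all: by end_near. Qed.
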